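(* Let $\{\alpha_n\}_{n\in\mathbb{N}}$ be a sequence of continuous isometric actions of a locally compact, $\sigma$-compact amenable group $G$ on compact metric spaces $(X_n,d_n)$, and let $p\ge 1$. If $d_{GH}(\alpha_n,\alpha)\to 0$ as $n\to\infty$ for some action $\alpha$ of $G$ on a compact metric space $(X,d)$, then $\alpha$ is an isometric action and $$\lim_{n\to\infty}d_{GH}\big(P_p^G(X_n),P_p^G(X)\big)=0,$$ where in the last formula $d_{GH}$ denotes the ordinary Gromov-Hausdorff distance between metric spaces, and $P_p^G(X_n)$, $P_p^G(X)$ are the spaces of Borel probability measures invariant under $\alpha_n$, respectively $\alpha$, with the metric $W_p$.
   Context: For an action $\alpha$ write $\alpha_g$ for the map given by $g\in G$; the action is isometric if every $\alpha_g$ is an isometry. Amenable: a locally compact group $G$ with left Haar measure $\lambda$ is amenable if for every compact $K\subset G$ and $\varepsilon>0$ there is a Borel set $F\subset G$ with $0<\lambda(F)<\infty$ and $\lambda(gF\Delta F)/\lambda(F)<\varepsilon$ for every $g\in K$. For a compact metric space $(X,d)$, $P_p(X)$ is the set of all Borel probability measures on $X$ with the Wasserstein metric $W_p(\mu,\nu)=\left(\inf_{\pi}\int_{X\times X}d(x_1,x_2)^p\,d\pi(x_1,x_2)\right)^{1/p}$, where $\pi$ ranges over all Borel probability measures on $X\times X$ with marginals $\mu$ and $\nu$. $P_p^G(X)$ is the subset of measures $\mu$ with $(\alpha_g)_*\mu=\mu$ for all $g\in G$, equipped with the restriction of $W_p$. An $\varepsilon$-isometry $f:(X,d_X)\to(Y,d_Y)$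 is a map (not necessarily continuous) with $|d_Y(f(x_1),f(x_2))-d_X(x_1,x_2)|\le\varepsilon$ for all $x_1,x_2\in X$ and such that every $y\in Y$ satisfies $d_Y(y,f(x))\le\varepsilon$ for some $x\in X$. For actions $\alpha,\beta$ of $G$ on metric spaces $X,Y$, an $\varepsilon$-GHA from $\alpha$ to $\beta$ is an $\varepsilon$-isometry $f:X\to Y$ with $\sup_{x\in X}d_Y(\beta_g(f(x)),f(\alpha_g(x)))\le\varepsilon$ for every $g\in G$. The equivariant distance $d_{GH}(\alpha,\beta)$ between actions is the infimum of the $\varepsilon>0$ for which there exist both an $\varepsilon$-GHA from $\alpha$ to $\beta$ and an $\varepsilon$-GHA from $\beta$ to $\alpha$ (with $\inf\varnothing=+\infty$). *)

(* Defs.v *)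
From HB Require Import structures.
From mathcomp Require Import all_boot all_order all_algebra.
From mathcomp Require Import all_classical all_reals all_analysis.

Set Implicit Arguments.
Unset Strict Implicit.
Unset Printing Implicit Defensive.

Import Order.TTheory GRing.Theory Num.Theory.
Import numFieldNormedType.Exports.

Local Open Scope classical_set_scope.
Local Open Scope ring_scope.

(* [measurableType] is built on pointed types, whence the [Pointed] component
   below. For metric spaces it amounts to nonemptiness; for groups it is
   harmless, and the distinguished point need not be the unit. *)
#[short(type="pmetricType")]
HB.structure Definition PMetric (K : numDomainType) :=
  {M of Metric K M & Pointed M}.

HB.mixin Record isTopologicalGroup G of Group G & Topological G := {
  mulg_continuous : continuous (fun xy : G * G => (xy.1 * xy.2)%g) ;
  invg_continuous : continuous (fun x : G => x^-1%g)
}.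

#[short(type="topologicalGroupType")]
HB.structure Definition TopologicalGroup :=
  {G of Group G & Topological G & Pointed G & isTopologicalGroup G}.

Notation borel T := (g_sigma_algebraType (@open T)).

Section groups.
Variables (R : realType) (G : topologicalGroupType).

Definition sigma_compact (T : topologicalType) :=
  exists2 K : nat -> set T, (forall n, compact (K n)) &
    \bigcup_n K n = [set: T].

Definition ltranslate (g : G) (A : set G) : set G := [set (g * x)%g | x in A].

(* Left-invariant nonzero Radon measure, with the usual regularity conditions
   (outer on Borel sets, inner on open sets). *)
Definition left_haar (lambda : {measure set (borel G) -> \bar R}) :=
  [/\ lambda [set: G] != 0%E,
      (forall (g : G) (A : set (borel G)), measurable A ->
         lambda (ltranslate g A) = lambda A),
      (forall K : set G, compact K -> (lambda K < +oo)%E),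
      (forall A : set (borel G), measurable A ->
         lambda A =
         ereal_inf [set lambda U | U in [set U : set G | open U /\ A `<=` U]]) &
      (forall U : set G, open U ->
         lambda U =
         ereal_sup [set lambda K | K in [set K : set G | compact K /\ K `<=` U]])].

Definition amenable :=
  exists2 lambda : {measure set (borel G) -> \bar R}, left_haar lambda &
    forall (K : set G) (eps : R), compact K -> 0 < eps ->
      exists F : set (borel G),
        [/\ measurable F, (0 < lambda F)%E, (lambda F < +oo)%E &
            forall g : G, K g ->
              (lambda (ltranslate g F `+` F) / lambda F < eps%:E)%E].

End groups.

Record group_action (G : groupType) (X : Type) := GroupAction {
  act :> G -> X -> X ;
  act1 : forall x, act 1%g x = x ;
  actM : forall g h x, act (g * h)%g x = act g (act h x)
}.

Definition continuous_action (G : topologicalGroupType) (X : topologicalType)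
    (alpha : group_action G X) :=
  continuous (fun gx : G * X => alpha gx.1 gx.2).

Definition isometric_action (R : realType) (G : groupType) (X : metricType R)
    (alpha : group_action G X) :=
  forall g x y, mdist (alpha g x) (alpha g y) = mdist x y.

Section equivariant_distance.
Variables (R : realType) (G : groupType).

Definition eps_isometry (X Y : metricType R) (eps : R) (f : X -> Y) :=
  (forall x1 x2, `|mdist (f x1) (f x2) - mdist x1 x2| <= eps) /\
  (forall y, exists x, mdist y (f x) <= eps).

Definition eps_GHA (X Y : metricType R) (alpha : group_action G X)
    (beta : group_action G Y) (eps : R) (f : X -> Y) :=
  eps_isometry eps f /\
  forall g, (ereal_sup [set (mdist (beta g (f x)) (f (alpha g x)))%:E
                       | x in [set: X]] <= eps%:E)%E.

Definition equivariant_GH (X Y : metricType R) (alpha : group_action G X)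
    (beta : group_action G Y) : \bar R :=
  ereal_inf [set eps%:E | eps in [set eps : R |
    [/\ 0 < eps, exists f, eps_GHA alpha beta eps f &
        exists f, eps_GHA beta alpha eps f]]].

End equivariant_distance.

Section gromov_hausdorff.
Variable R : realType.

Definition hausdorff_distance (Z : metricType R) (A B : set Z) : \bar R :=
  ereal_inf [set r%:E | r in [set r : R |
    [/\ 0 < r, forall a, A a -> exists2 b, B b & mdist a b < r &
        forall b, B b -> exists2 a, A a & mdist a b < r]]].

(* Infimum, over all metric spaces Z and all distance-preserving maps into Z,
   of the Hausdorff distance of the images. The spaces are given as types with
   a distance function; since the maps are not asked to be injective, points at
   distance 0 are identified. This matters for measures: two terms of type
   [probability T R] may differ on non-measurable sets while being the same
   measure, and their Wasserstein distance is then 0. *)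
Definition gromov_hausdorff (T1 T2 : Type) (d1 : T1 -> T1 -> R)
    (d2 : T2 -> T2 -> R) : \bar R :=
  ereal_inf [set e : \bar R |
    exists (Z : metricType R) (f1 : T1 -> Z) (f2 : T2 -> Z),
      [/\ forall x y, mdist (f1 x) (f1 y) = d1 x y,
          forall x y, mdist (f2 x) (f2 y) = d2 x y &
          e = hausdorff_distance (range f1) (range f2)]].

End gromov_hausdorff.

Section wasserstein.
Variables (R : realType) (X : pmetricType R).

(* The Borel sigma-algebra on X * X is that of the product topology. *)
Definition coupling (mu nu : probability (borel X) R) :
    set (probability (borel (X * X)%type) R) :=
  [set pi | forall A : set (borel X), measurable A ->
     pushforward pi (fst : borel (X * X)%type -> borel X) A = mu A /\
     pushforward pi (snd : borel (X * X)%type -> borel X) A = nu A].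

Definition wasserstein (p : R) (mu nu : probability (borel X) R) : R :=
  fine (poweR
    (ereal_inf [set (\int[pi]_(z in [set: X * X])
                       (mdist (z.1 : X) (z.2 : X) `^ p)%:E)%E
               | pi in coupling mu nu])
    p^-1).

Definition invariant_measure (G : groupType) (alpha : group_action G X)
    (mu : probability (borel X) R) :=
  forall (g : G) (A : set (borel X)), measurable A ->
    pushforward mu (alpha g : borel X -> borel X) A = mu A.

Definition invariant_probability (G : groupType) (alpha : group_action G X) :=
  {mu : probability (borel X) R | invariant_measure alpha mu}.

Definition invariant_wasserstein (G : groupType) (alpha : group_action G X)
    (p : R) (mu nu : invariant_probability alpha) : R :=
  wasserstein p (sval mu) (sval nu).

End wasserstein.

Arguments invariant_wasserstein {R X G} alpha p mu nu.

(* Main.v *)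
Require Import Defs.
From HB Require Import structures.
From mathcomp Require Import all_boot all_order all_algebra.
From mathcomp Require Import all_classical all_reals all_analysis.
From mathcomp Require Import measurable_realfun lra.

Import Order.TTheory GRing.Theory Num.Theory.
Import numFieldNormedType.Exports.

Local Open Scope classical_set_scope.
Local Open Scope ring_scope.

(* An e-approximation f from alpha to beta yields the closed set E of pairs
   (x, y) such that d(x, x') and d(y, f x') differ by at most 4e for all x'.
   The set E has distortion at most 8e, and the orbit under the diagonal action
   of (x, f x), as well as that of (x, y) with f x close to y, stays in E. Call
   two invariant measures related when they have a coupling concentrated on E;
   then their Wasserstein distances differ by at most 8e, so it remains to show
   that every invariant measure mu is related to some invariant measure. For x
   of law mu and g independent of x and uniform on a Folner set, the law of
   (gx, g f(x)), where f is replaced by a function with finitely many values,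
   has first marginal mu, is concentrated on E and is almost invariant. A
   cluster point of these laws is an invariant coupling on E; its second
   marginal is the required measure. *)

Set Implicit Arguments.
Unset Strict Implicit.
Unset Printing Implicit Defensive.

(** * Borel sets and Borel measures *)

(** The image of [mu] under f is no candidate for the related measure: f need be neither continuous
    nor measurable, and it commutes with the actions only approximately. Averaging the pair (x, f x)
    instead of f x alone restores invariance and at the same time keeps the comparison with [mu],
    which becomes a closed condition on pairs. Such a condition survives weak limits, and testing it
    against all x' makes E closed however irregular f is. The same E serves in both directions,
    because the orbit condition holds with X and Y exchanged; hence a single relation between
    invariant measures is total on both sides. The limit action is not assumed isometric or
    continuous. Isometry and continuity of its orbit maps are inherited through approximations from
    alpha to alpha_n, whereas E is built from the maps in the opposite direction. Weak limits are
    taken on masses of closed sets, which converge along an ultrafilter to a content. Couplings are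
    glued only up to a small error, which is absorbed because the Wasserstein inequalities are
    proved up to an arbitrary positive error. *)

HB.instance Definition _ (S T : ptopologicalType) := Pointed.on (S * T)%type.

Lemma open_borel (T : ptopologicalType) (U : set T) :
  open U -> measurable (U : set (borel T)).
Proof. by move=> oU; apply: sub_sigma_algebra. Qed.

Lemma closed_borel (T : ptopologicalType) (C : set T) :
  closed C -> measurable (C : set (borel T)).
Proof.
by move=> cC; rewrite -[C]setCK; apply: measurableC; apply: open_borel;
  rewrite openC.
Qed.

Lemma measurable_fun_borel d (S : measurableType d) (T : ptopologicalType)
    (f : S -> T) :
  (forall U, open U -> measurable (f @^-1` U)) ->
  measurable_fun setT (f : S -> borel T).
Proof.
move=> mf; apply: (@measurability _ _ _ (borel T) setT f (@open T)) => //.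
by move=> _ [U oU <-]; rewrite setTI; exact: mf.
Qed.

Lemma continuous_measurable_borel (S T : ptopologicalType) (f : S -> T) :
  continuous f -> measurable_fun setT (f : borel S -> borel T).
Proof.
move=> cf; apply: measurable_fun_borel => U oU; apply: open_borel.
by apply: open_comp => // x _; exact: cf.
Qed.

Lemma measurable_preimage d1 d2 (S : measurableType d1) (T : measurableType d2)
    (f : S -> T) (A : set T) :
  measurable_fun setT f -> measurable A -> measurable (f @^-1` A).
Proof. by move=> mf mA; rewrite -[_ @^-1` _]setTI; exact: mf. Qed.

Section metric.
Context {R : realType} {X : pmetricType R}.
Implicit Types (x y : X) (A : set X).

Lemma ball_mdistP x e y : ball x e y <-> mdist x y < e.
Proof. by rewrite ballEmdist. Qed.

Lemma open_ball_mdist x (e : R) : open (ball x e).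
Proof.
rewrite openE => y /ball_mdistP xy; apply/nbhs_ballP.
exists (e - mdist x y) => /=; first by rewrite subr_gt0.
move=> z /ball_mdistP yz; apply/ball_mdistP.
rewrite (le_lt_trans (metric_triangle _ y _))//; lra.
Qed.

Lemma mdist_lipschitz x x' y y' :
  `|mdist x y - mdist x' y'| <= mdist x x' + mdist y y'.
Proof.
have := metric_triangle x x' y; have := metric_triangle x' y' y.
have := metric_triangle x' x y'; have := metric_triangle x y y'.
by rewrite (metric_sym x' x) (metric_sym y' y) ler_norml => *; apply/andP; lra.
Qed.

End metric.

Lemma mdist_continuous (R : realType) (T : topologicalType) (X : pmetricType R)
    (f g : T -> X) :
  continuous f -> continuous g -> continuous (fun t => mdist (f t) (g t)).
Proof.
move=> cf cg t; apply/cvgrPdist_le => e e0.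
have e2 : 0 < e / 2 by lra.
have Hf : \forall t' \near t, mdist (f t) (f t') < e / 2.
  have := cf t _ (nbhsx_ballx (f t) _ e2).
  by apply: (@filterS _ (nbhs t)) => t' /ball_mdistP.
have Hg : \forall t' \near t, mdist (g t) (g t') < e / 2.
  have := cg t _ (nbhsx_ballx (g t) _ e2).
  by apply: (@filterS _ (nbhs t)) => t' /ball_mdistP.
near=> t'.
rewrite (le_trans (mdist_lipschitz _ _ _ _))//.
have : mdist (f t) (f t') < e / 2 by near: t'.
have : mdist (g t) (g t') < e / 2 by near: t'.
lra.
Unshelve. all: by end_near. Qed.

Section product.
Context {R : realType}.

(** Compact metric spaces are second countable, so U is a countable union of open rectangles. This
    links the Borel sets of the product topology, on which couplings live, to the product
    sigma-algebra, in which pairs of measurable maps and product measures are handled. *)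
Lemma open_product_measurable (X Y : pmetricType R) (U : set (X * Y)) :
  compact [set: X] -> compact [set: Y] -> open U ->
  measurable (U : set (borel X * borel Y)).
Proof.
move=> cX cY oU.
have [BX cBX [oBX bX]] := compact_second_countable cX.
have [BY cBY [oBY bY]] := compact_second_countable cY.
pose D := (BX `*` BY) `&` [set AB | AB.1 `*` AB.2 `<=` U].
have cD : countable D.
  apply: (@sub_countable _ _ _ (BX `*` BY)); last exact: countableX.
  by apply: subset_card_le; exact: subIsetl.
have -> : (U : set (borel X * borel Y)) =
    \bigcup_(AB in D) ((AB.1 : set (borel X)) `*` (AB.2 : set (borel Y))).
  apply/seteqP; split=> [[x y] Uxy|[x y] [AB [_ +]]]; last exact.
  have [[P Q] [/= /bX[A [BA Ax] AP] /bY[B [BB By] BQ]] PQU] :=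
    (open_nbhs_nbhs (conj oU Uxy) : nbhs (x, y) U).
  exists (A, B) => //; split=> // -[a b] [/= Aa Bb].
  by apply: PQU; split; [exact: AP|exact: BQ].
rewrite bigcup_set_type; apply: countable_bigcupT_measurable; last first.
  move=> [AB /set_mem[[/= A1 A2] _]].
  by apply: measurableX => /=; apply: open_borel; [exact: oBX|exact: oBY].
by rewrite (eq_countable (card_setT _)).
Qed.

Lemma measurable_fun_borel_pair d (S : measurableType d) (X Y : pmetricType R)
    (f : S -> X) (g : S -> Y) : compact [set: X] -> compact [set: Y] ->
  measurable_fun setT (f : S -> borel X) ->
  measurable_fun setT (g : S -> borel Y) ->
  measurable_fun setT ((fun s => (f s, g s)) : S -> borel (X * Y)%type).
Proof.
move=> cX cY mf mg; apply: measurable_fun_borel => U oU.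
rewrite -[_ @^-1` _]setTI.
exact: (measurable_fun_pair mf mg) (open_product_measurable cX cY oU).
Qed.

Lemma measurable_mdist d (S : measurableType d) (X : pmetricType R)
    (f g : S -> X) : compact [set: X] ->
  measurable_fun setT (f : S -> borel X) ->
  measurable_fun setT (g : S -> borel X) ->
  measurable_fun setT (fun s => mdist (f s) (g s)).
Proof.
move=> cX mf mg.
apply: (measurability _ (RGenOpens.measurableE R)) => //.
move=> _ [_ [a [b ->]] <-]; rewrite setTI.
pose B := (fun z : X * X => mdist z.1 z.2) @^-1` `]a, b[.
rewrite -[_ @^-1` _]setTI.
have mB : measurable (B : set (borel (X * X)%type)).
  apply: open_borel; apply: open_comp => [z _|]; last exact: interval_open.
  by apply: mdist_continuous z => z; [exact: cvg_fst|exact: cvg_snd].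
exact: (measurable_fun_borel_pair cX cX mf mg measurableT mB).
Qed.

Lemma mdist_bounded (X : pmetricType R) : compact [set: X] ->
  exists M, forall x y : X, mdist x y <= M.
Proof.
move=> cX; have cXX : compact [set: X * X].
  by rewrite -setXTT; exact: compact_setX.
have X0 : [set: X * X] !=set0 by exists (point, point).
have cd : {within [set: X * X], continuous (fun z : X * X => mdist z.1 z.2)}.
  apply: continuous_subspaceT; apply: mdist_continuous => z;
    [exact: cvg_fst|exact: cvg_snd].
have [z _ zmax] := compact_EVT_max X0 cXX cd.
by exists (mdist z.1 z.2) => x y; apply: (zmax (x, y)); rewrite inE.
Qed.

End product.

Lemma probability_pushforward (R : realType) d d' (S : measurableType d)
    (T : measurableType d') (P : probability S R) (f : S -> T) :
  measurable_fun setT f ->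
  exists Q : probability T R, forall A, Q A = P (f @^-1` A).
Proof.
move=> mf; pose m := isMeasurableFun.Build _ _ _ _ f mf.
pose F : {mfun S >-> T} := HB.pack f m.
by exists (distribution P F).
Qed.

(** Taking complements reverses the inequality on closed sets, and U is the increasing union of the
    closed sets [C n] of points at distance at least [d n] from its complement; so P and Q agree on
    open sets, a generating family stable under intersection. One-sided bounds on open sets are
    exactly what a weak limit provides. *)
Lemma probability_open_le (R : realType) (X : pmetricType R)
    (P Q : probability (borel X) R) :
  (forall U : set X, open U -> (P U <= Q U)%E) ->
  forall A, measurable A -> P A = Q A.
Proof.
move=> PQ.
suff PQo (U : set X) : open U -> P U = Q U.
  move=> A mA.
  have oI : setI_closed (@open X) by move=> U V; exact: openI.
  apply: (@measure_unique _ R (borel X) (@open X) (fun=> setT) _ oI _ _ P Q) => //.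
  - by move=> _; exact: openT.
  - by rewrite bigcup_const.
  - by move=> k; apply: le_lt_trans (probability_le1 P _) (ltry _).
move=> oU; apply/eqP; rewrite eq_le PQ//=.
pose d n := (n.+1%:R^-1 : R).
pose C n : set X := ~` \bigcup_(y in ~` U) ball y (d n).
have cC n : closed (C n).
  by apply: open_closedC; apply: bigcup_open => y _; exact: open_ball_mdist.
have UC : \bigcup_n C n = U.
  rewrite -setC_bigcap -[RHS]setCK; congr (~` _); apply/seteqP; split=> [x|x Ux n _].
    move=> xB; apply: contrapT => /notP Ux.
    have /nbhs_ballP[e /= e0 eU] := open_nbhs_nbhs (conj oU Ux).
    have [n _ ne] : \forall n \near \oo, d n < e.
      exact: near_infty_natSinv_lt (PosNum e0).
    have [y Uy /ball_mdistP yx] := xB n I.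
    apply: Uy; apply: eU; apply/ball_mdistP.
    by rewrite metric_sym (lt_trans yx)// ne/=.
  exists x => //; apply/ball_mdistP; rewrite mdistxx.
  by rewrite invr_gt0.
have QC : Q \o C @ \oo --> Q U.
  rewrite -UC; apply: nondecreasing_cvg_mu.
  - by move=> n; exact: closed_borel.
  - by rewrite UC; exact: open_borel.
  - move=> m n mn; apply/subsetPset; apply: subsetC => x [y Uy] /ball_mdistP yx.
    exists y => //; apply/ball_mdistP; apply: lt_le_trans yx _.
    by rewrite lef_pV2 ?posrE// ler_nat.
apply: (cvge_to_le QC); apply: nearW => n /=.
have mC := closed_borel (cC n).
apply: (@le_trans _ _ (P (C n))); last first.
  apply: le_measure; rewrite ?inE//; first exact: open_borel.
  by rewrite -UC; exact: bigcup_sup.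
have := PQ _ (closed_openC (cC n)).
rewrite (probability_setC P mC) (probability_setC Q mC).
have : P (C n) \is a fin_num by rewrite fin_num_measure.
have : Q (C n) \is a fin_num by rewrite fin_num_measure.
move: (P (C n)) (Q (C n)) => [p| |] [q| |]//= _ _.
rewrite -!EFinB !lee_fin; lra.
Qed.

(** * Probability measures from contents on compact Hausdorff spaces *)

Section content.
Context {R : realType} {T : ptopologicalType}.
Hypotheses (T_hausdorff : hausdorff_space T) (T_compact : compact [set: T]).

Variable w : set T -> R.
Hypotheses (w_homo : forall A B, closed A -> closed B -> A `<=` B -> w A <= w B)
  (w_subadd : forall A B, closed A -> closed B -> w (A `|` B) <= w A + w B)
  (w_add : forall A B, closed A -> closed B -> A `&` B = set0 ->
     w (A `|` B) = w A + w B)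
  (w_setT : w setT = 1).

(** The classical passage from a content on compact sets to a regular Borel measure; closed sets
    play the part of compact ones, as the space is compact. This is the value on open sets, and
    [outer_content] extends it to an outer measure. *)
Definition inner_content (U : set T) : \bar R :=
  ereal_sup [set (w C)%:E | C in [set C | closed C /\ C `<=` U]].

Definition outer_content (A : set T) : \bar R :=
  ereal_inf [set inner_content U | U in [set U | open U /\ A `<=` U]].

Local Lemma w_set0 : w set0 = 0.
Proof.
have := @w_add set0 set0 closed0 closed0 (setI0 _).
by rewrite setU0; lra.
Qed.

Local Lemma inner_content_ub C U : closed C -> C `<=` U ->
  ((w C)%:E <= inner_content U)%E.
Proof. by move=> cC CU; apply: ereal_sup_ubound; exists C. Qed.

Local Lemma inner_content_ge0 U : (0 <= inner_content U)%E.
Proof. by have := inner_content_ub closed0 (@sub0set _ U); rewrite w_set0. Qed.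

Local Lemma inner_content_le1 U : (inner_content U <= 1)%E.
Proof.
apply: ge_ereal_sup => _ [C [cC _] <-].
by rewrite lee_fin -w_setT; apply: w_homo => //; exact: closedT.
Qed.

Local Lemma inner_content_setT : inner_content setT = 1%E.
Proof.
apply/eqP; rewrite eq_le inner_content_le1/= -w_setT.
by apply: inner_content_ub => //; exact: closedT.
Qed.

Local Lemma le_inner_content U V : U `<=` V ->
  (inner_content U <= inner_content V)%E.
Proof.
move=> UV; apply: ge_ereal_sup => _ [C [cC CU] <-].
by apply: inner_content_ub => //; exact: subset_trans UV.
Qed.

Local Lemma inner_content_fin_num U : inner_content U \is a fin_num.
Proof.
rewrite fin_numElt (lt_le_trans _ (inner_content_ge0 U)) ?ltNyr//=.
exact: le_lt_trans (inner_content_le1 U) (ltry _).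
Qed.

(** By normality, the closed set C minus V has an open neighbourhood W whose closure stays in U;
    then C is covered by a closed part inside U and the closed part C minus W inside V. *)
Local Lemma inner_contentU2 U V : open U -> open V ->
  (inner_content (U `|` V) <= inner_content U + inner_content V)%E.
Proof.
move=> oU oV; apply: ge_ereal_sup => _ [C [cC CUV] <-].
have cCV : closed (C `\` V).
  by rewrite setDE; apply: closedI => //; exact: open_closedC.
have CVU : C `\` V `<=` U by move=> x [/CUV[]].
have /(compact_normal T_hausdorff T_compact cCV)[D] : set_nbhs (C `\` V) U.
  by apply/set_nbhsP; exists U; split.
move=> /set_nbhsP[W [oW CVW WD] DU].
have cCD : closed (C `&` closure D).
  by apply: closedI => //; exact: closed_closure.
have cCW : closed (C `\` W).
  by rewrite setDE; apply: closedI => //; exact: open_closedC.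
apply: (@le_trans _ _ (w (C `&` closure D) + w (C `\` W))%:E).
  rewrite lee_fin (le_trans _ (w_subadd cCD cCW))//; apply: w_homo => //.
    exact: closedU.
  move=> x Cx; have [Wx|nWx] := pselect (W x); [left|right] => //.
  by split=> //; apply: subset_closure; exact: WD.
rewrite EFinD; apply: leeD; apply: inner_content_ub => //.
  by move=> x [_ /DU].
by move=> x [Cx Wx]; apply: contrapT => Vx; apply: Wx; exact: CVW.
Qed.

(** A closed C inside the union is compact, hence lies in finitely many [U n], and binary
    subadditivity applies. *)
Local Lemma inner_content_bigcup (U : (set T)^nat) : (forall n, open (U n)) ->
  (inner_content (\bigcup_n U n) <= \sum_(n <oo) inner_content (U n))%E.
Proof.
move=> oU; apply: ge_ereal_sup => _ [C [cC CU] <-].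
have : compact C by apply: (subclosed_compact cC T_compact).
rewrite compact_cover => /(_ _ [set: nat] U) [//|//|D _ CD].
pose N := (\max_(i <- finmap.enum_fset D) i).+1.
have {CD}CN : C `<=` \big[setU/set0]_(i < N) U i.
  move=> x /CD[i /= iD Uix]; rewrite -bigcup_mkord; exists i => //=.
  by rewrite /N ltnS; exact: leq_bigmax_seq.
apply: (@le_trans _ _ (\sum_(i < N) inner_content (U i))%E); last first.
  rewrite -(big_mkord xpredT (fun i => inner_content (U i))).
  by apply: nneseries_lim_ge => n _ _; exact: inner_content_ge0.
apply: (@le_trans _ _ (inner_content (\big[setU/set0]_(i < N) U i))).
  exact: inner_content_ub.
elim: N {CN} => [|n IH].
  rewrite !big_ord0; apply: ge_ereal_sup => _ [A [_ A0] <-].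
  by move: A0; rewrite subset0 => ->; rewrite w_set0.
rewrite !big_ord_recr/=; apply: le_trans (leeD IH (lexx _)).
by apply: inner_contentU2 => //; rewrite -bigcup_mkord; apply: bigcup_open.
Qed.

Local Lemma outer_content_open U : open U -> outer_content U = inner_content U.
Proof.
move=> oU; apply/eqP; rewrite eq_le; apply/andP; split.
  by apply: ereal_inf_lbound; exists U => //; split.
by apply: le_ereal_inf_tmp => _ [V [oV UV] <-]; exact: le_inner_content.
Qed.

Local Lemma outer_content_ge0 A : (0 <= outer_content A)%E.
Proof.
by apply: le_ereal_inf_tmp => _ [V [oV UV] <-]; exact: inner_content_ge0.
Qed.

Local Lemma outer_content_fin_num A : outer_content A \is a fin_num.
Proof.
rewrite fin_numElt (lt_le_trans _ (outer_content_ge0 A)) ?ltNyr//=.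
apply: le_lt_trans (ltry 1); rewrite -inner_content_setT.
by apply: ereal_inf_lbound; exists setT => //; split => //; exact: openT.
Qed.

Local Lemma outer_content_near A (e : R) : 0 < e ->
  exists U, [/\ open U, A `<=` U & (inner_content U <= outer_content A + e%:E)%E].
Proof.
move=> e0.
have [_ [U [oU AU] <-] /ltW le] := lb_ereal_inf_adherent e0 (outer_content_fin_num A).
by exists U.
Qed.

Local Lemma le_outer_content A B : A `<=` B ->
  (outer_content A <= outer_content B)%E.
Proof.
move=> AB; apply: le_ereal_inf_tmp => _ [V [oV BV] <-].
by apply: ereal_inf_lbound; exists V => //; split=> //; exact: subset_trans BV.
Qed.

Local Lemma outer_content0 : outer_content set0 = 0%E.
Proof.
rewrite outer_content_open; last exact: open0.
apply/eqP; rewrite eq_le inner_content_ge0 andbT.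
apply: ge_ereal_sup => _ [A [_ A0] <-].
by move: A0; rewrite subset0 => ->; rewrite w_set0.
Qed.

Local Lemma outer_content_sigma_subadditive : sigma_subadditive outer_content.
Proof.
move=> A; apply/lee_addgt0Pr => e e0.
have e2 n : 0 < e / (2 ^ n.+1)%:R by rewrite divr_gt0// ltr0n expn_gt0.
have [U UP] := choice (fun n => outer_content_near (A n) (e2 n)).
apply: le_trans (epsilon_trick _ _ (ltW e0)); last first.
  by move=> n; exact: outer_content_ge0.
apply: (@le_trans _ _ (\sum_(n <oo) inner_content (U n))%E); last first.
  apply: lee_nneseries => [n _ _|n _]; first exact: inner_content_ge0.
  by have [] := UP n.
apply: le_trans (inner_content_bigcup _); last by move=> n; have [] := UP n.
rewrite -outer_content_open; last first.
  by apply: bigcup_open => n _; have [] := UP n.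
by apply: le_outer_content; apply: subset_bigcup => n _; have [] := UP n.
Qed.

HB.instance Definition _ := isOuterMeasure.Build R T outer_content
  outer_content0 outer_content_ge0 le_outer_content
  outer_content_sigma_subadditive.

(** Take an open V around A of nearly the same outer content, a closed C nearly exhausting the
    intersection of V and U, and a closed D nearly exhausting V minus C, which contains A minus U.
    As C and D are disjoint, [w_add] bounds the sum of their contents by that of V. The errors e/2,
    e/4 and e/4 add up to e. *)
Local Lemma open_caratheodory U : open U -> outer_content.-caratheodory U.
Proof.
move=> oU; apply: le_caratheodory_measurable => A.
apply/lee_addgt0Pr => e e0; have e2 : 0 < e / 2 by lra.
have e4 : 0 < e / 4 by lra.
have [V [oV AV]] := outer_content_near A e2.
have oVU : open (V `&` U) by exact: openI.
have [_ [C [cC CVU] <-] wC] :=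
  ub_ereal_sup_adherent e4 (inner_content_fin_num (V `&` U)).
have oVC : open (V `\` C) by rewrite setDE; apply: openI => //; exact: closed_openC.
have [_ [D [cD DVC] <-] wD] :=
  ub_ereal_sup_adherent e4 (inner_content_fin_num (V `\` C)).
have wCD : ((w C + w D)%:E <= inner_content V)%E.
  rewrite -w_add//.
    apply: inner_content_ub; first exact: closedU.
    by move=> x [/CVU[]//|/DVC[]].
  by apply/seteqP; split=> // x [Cx /DVC[]].
have AU : (outer_content (A `&` U) <= inner_content (V `&` U))%E.
  by rewrite -outer_content_open//; apply: le_outer_content; exact: setSI.
have AnU : (outer_content (A `&` ~` U) <= inner_content (V `\` C))%E.
  rewrite -outer_content_open//; apply: le_outer_content => x [/AV Vx Ux].
  by split=> // /CVU[].
move: wC wD wCD AU AnU.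
move: (outer_content_fin_num A) (outer_content_fin_num (A `&` U))
  (outer_content_fin_num (A `&` ~` U)) (inner_content_fin_num V)
  (inner_content_fin_num (V `&` U)) (inner_content_fin_num (V `\` C)).
rewrite /= -!/(inner_content _).
move=> /fineK <- /fineK <- /fineK <- /fineK <- /fineK <- /fineK <-.
rewrite -!EFinB -!EFinD !lte_fin !lee_fin; lra.
Qed.

Lemma content_probability : exists P : probability (borel T) R,
  forall U, open U -> P U = inner_content U.
Proof.
have sub : <<s @open T >> `<=` outer_content.-caratheodory.
  apply: smallest_sub; last exact: open_caratheodory.
  exact: (sigma_algebra_measurable (caratheodory_type outer_content)).
pose m (A : set (borel T)) := outer_content A.
have m0 : m set0 = 0%E by exact: outer_content0.
have mge0 A : (0 <= m A)%E by exact: outer_content_ge0.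
have madd : semi_sigma_additive m.
  move=> F mF tF mUF.
  exact: (@caratheodory_measure_sigma_additive _ _ outer_content F
    (fun n => sub _ (mF n)) tF (sub _ mUF)).
pose M0 := isMeasure.Build _ _ _ m m0 mge0 madd.
pose M1 : {measure set (borel T) -> \bar R} := HB.pack m M0.
have M1T : M1 setT = 1%E.
  by rewrite -inner_content_setT -outer_content_open//; exact: openT.
pose M2 := Measure_isProbability.Build _ _ _ M1 M1T.
pose P : probability (borel T) R := HB.pack m M0 M2.
by exists P => U oU; rewrite -outer_content_open.
Qed.

End content.

(** * Approximate gluing of couplings *)

(** The colour of x is the position of the first ball of radius [d / 2], in a finite cover, that
    contains x. The cells are therefore Boolean combinations of open balls. *)
Lemma finite_borel_coloring (R : realType) (X : pmetricType R) (d : R) :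
  compact [set: X] -> 0 < d ->
  exists N (c : X -> nat),
    [/\ forall x, (c x < N)%N,
        forall k, measurable (c @^-1` [set k] : set (borel X)) &
        forall x y, c x = c y -> mdist x y <= d].
Proof.
move=> cX d0; have d20 : 0 < d / 2 by lra.
move: (cX); rewrite compact_cover.
move=> /(_ X setT (fun x => ball x (d / 2)))[||s _ sX].
- by move=> x _; exact: open_ball_mdist.
- by move=> x _; exists x => //; exact: ballxx.
pose c x := find (fun y => mdist y x < d / 2) (finmap.enum_fset s).
have c_lt x : (c x < size (finmap.enum_fset s))%N.
  rewrite -has_find; have [y /= ys /ball_mdistP yx] := sX x I.
  by apply/hasP; exists y.
exists (size (finmap.enum_fset s)), c; split => //.
  rewrite /c; elim: (finmap.enum_fset s) => /= [k|y t IH k].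
    by have [->|k0] := eqVneq k 0%N;
      [rewrite preimage_cst ifT ?inE//|rewrite preimage_cst ifF//];
      apply/negbTE; rewrite notin_setE => /= k0'; rewrite -k0' eqxx in k0.
  have mb : measurable (ball y (d / 2) : set (borel X)).
    by apply: open_borel; exact: open_ball_mdist.
  case: k => [|k].
    rewrite (_ : _ @^-1` _ = ball y (d / 2))//.
    by apply/seteqP; split=> x /=; rewrite ballEmdist/=; case: ifPn.
  rewrite (_ : _ @^-1` _ = ~` ball y (d / 2) `&`
    (fun x => find (fun y => mdist y x < d / 2) t) @^-1` [set k]).
    exact: measurableI (measurableC mb) (IH k).
  apply/seteqP; split=> x /=; rewrite ballEmdist/=.
    by case: ifPn => // /negP + [<-].
  by case=> + <-; case: ifPn.
move=> x y xy; have hx : has (fun y => mdist y x < d / 2) (finmap.enum_fset s).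
  by rewrite has_find; exact: c_lt.
have hy : has (fun z => mdist z y < d / 2) (finmap.enum_fset s).
  by rewrite has_find; exact: c_lt.
have := nth_find point hy; have := nth_find point hx.
rewrite -/(c x) -/(c y) xy; set z := nth _ _ _ => zx zy.
by rewrite (le_trans (metric_triangle x z y))// (metric_sym x z); lra.
Qed.

Lemma ae_pushforward (R : realType) d1 d2 (S : measurableType d1)
    (T : measurableType d2) (P : probability S R)
    (Q : probability T R) (f : S -> T) (A : T -> Prop) :
  measurable_fun setT f ->
  (forall B, measurable B -> P (f @^-1` B) = Q B) ->
  {ae Q, forall t, A t} -> {ae P, forall s, A (f s)}.
Proof.
move=> mf PQ [B [mB QB AB]]; exists (f @^-1` B); split.
- by rewrite -[_ @^-1` _]setTI; exact: mf.
- by rewrite PQ.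
- by move=> s /=; exact: AB.
Qed.

Lemma measure_sum_fibers (R : realType) d (S : measurableType d)
    (P : {measure set S -> \bar R}) (c : S -> nat) N (A : set S) :
  (forall s, (c s < N)%N) -> (forall k, measurable (c @^-1` [set k])) ->
  measurable A -> (\sum_(k < N) P (A `&` c @^-1` [set (k : nat)]) = P A)%E.
Proof.
move=> cN mc mA.
have mF (k : 'I_N) : measurable (A `&` c @^-1` [set (k : nat)]).
  exact: measurableI.
rewrite -measure_semi_additive_ord//; last 2 first.
- apply/trivIsetP => i j _ _ ij; apply/seteqP; split=> // s.
  by move=> [[_ /= ->]] [_ /= /val_inj/eqP]; rewrite (negbTE ij).
- by apply: bigsetU_measurable.
congr (P _); rewrite -(bigcup_mkord N (fun k => A `&` c @^-1` [set k])).
apply/seteqP; split=> [s [k _ []]//|s As].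
by exists (c s) => //=; exact: cN.
Qed.

(* Disintegration is avoided by taking the two coordinates conditionally
   independent given the cell, in a partition of X into small Borel pieces,
   which contains f1 and f2. *)
Lemma approximate_gluing (R : realType) d1 d2 (S1 : measurableType d1)
    (S2 : measurableType d2) (P1 : probability S1 R) (P2 : probability S2 R)
    (X : pmetricType R) (f1 : S1 -> X) (f2 : S2 -> X) (d : R) :
  compact [set: X] ->
  measurable_fun setT (f1 : S1 -> borel X) ->
  measurable_fun setT (f2 : S2 -> borel X) ->
  (forall A : set (borel X), measurable A -> P1 (f1 @^-1` A) = P2 (f2 @^-1` A)) ->
  0 < d ->
  exists Q : probability (S1 * S2)%type R,
    [/\ forall A, measurable A -> Q (fst @^-1` A) = P1 A,
        forall A, measurable A -> Q (snd @^-1` A) = P2 A &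
        {ae Q, forall z, mdist (f1 z.1) (f2 z.2) <= d}].
Proof.
move=> cX mf1 mf2 f12 d0.
have [N [c [cN mc cd]]] := finite_borel_coloring cX d0.
pose E1 k : set S1 := f1 @^-1` (c @^-1` [set k]).
pose E2 k : set S2 := f2 @^-1` (c @^-1` [set k]).
have mE1 k : measurable (E1 k) by rewrite -[E1 k]setTI; exact: mf1.
have mE2 k : measurable (E2 k) by rewrite -[E2 k]setTI; exact: mf2.
have E12 k : P1 (E1 k) = P2 (E2 k) by exact: f12.
(* This is [P2] conditioned on the cell. The default [P2], taken for a null cell, is harmless: [E12]
   then makes the whole summand vanish. *)
pose n2 k : probability S2 R := mnormalize (mrestr P2 (mE2 k)) P2.
pose m k : {measure set (S1 * S2) -> \bar R} := (mrestr P1 (mE1 k) \x n2 k)%E.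
have mE k A B : measurable A -> measurable B ->
    m k (A `*` B) = (P1 (A `&` E1 k) * n2 k B)%E.
  by move=> mA mB; exact: product_measure1E.
have n2E k B : measurable B -> (P2 (E2 k) * n2 k B = P2 (B `&` E2 k))%E.
  move=> mB; rewrite /n2 /= /mnormalize /= /mrestr setTI.
  have q_fin : P2 (E2 k) \is a fin_num by rewrite fin_num_measure.
  have [q0|q0] := eqVneq (P2 (E2 k)) 0%E.
    rewrite {1}q0 mul0e; apply/esym/eqP; rewrite -measure_le0 -q0.
    by apply: le_measure; rewrite ?inE//; exact: measurableI.
  rewrite /= ifF; last by apply/negbTE; move: q_fin; rewrite fin_numE => /andP[].
  rewrite -{1}(fineK q_fin) muleCA -EFinM divff ?mule1//.
  by rewrite fine_eq0.
have sum1 A : measurable A -> (\sum_(k < N) P1 (A `&` E1 k) = P1 A)%E.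
  by move=> mA; apply: (@measure_sum_fibers _ _ _ P1 (c \o f1) N) => // s; exact: cN.
have sum2 A : measurable A -> (\sum_(k < N) P2 (A `&` E2 k) = P2 A)%E.
  by move=> mA; apply: (@measure_sum_fibers _ _ _ P2 (c \o f2) N) => // s; exact: cN.
have Q1 A : measurable A -> msum m N (fst @^-1` A) = P1 A.
  move=> mA; rewrite -setXT /msum -sum1//; apply: eq_bigr => k _.
  by rewrite mE// probability_setT mule1.
have Q2 A : measurable A -> msum m N (snd @^-1` A) = P2 A.
  move=> mA; rewrite -setTX /msum -sum2//; apply: eq_bigr => k _.
  by rewrite mE// setTI E12 n2E.
have QT : msum m N setT = 1%E by rewrite -(preimage_setT fst) Q1// probability_setT.
pose Q : probability (S1 * S2)%type R :=
  HB.pack (msum m N) (Measure_isProbability.Build _ _ _ (msum m N) QT).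
exists Q; split=> //.
pose G := \bigcup_(k in `I_N) (E1 k `*` E2 k).
have mG : measurable G by apply: bigcup_measurable => k _; exact: measurableX.
exists (~` G); split.
- exact: measurableC.
- rewrite probability_setC//; suff -> : Q G = 1%E by rewrite subee.
  apply/eqP; rewrite eq_le probability_le1//=.
  rewrite -(probability_setT P1) -sum1//; apply: lee_sum => k _.
  apply: (@le_trans _ _ (m k (E1 k `*` E2 k))).
    by rewrite mE// setIid setTI E12 n2E// setIid.
  apply: le_measure; rewrite ?inE//; first exact: measurableX.
  by move=> z; exists k => //=.
- move=> z /= zd [k kN [/= c1 c2]]; apply: zd; apply: cd.
  by rewrite c1 c2.
Qed.

(** * The Wasserstein pseudometric *)

Section Lnorm.
Context d (T : measurableType d) (R : realType) (P : probability T R).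
Variable (p : R) (p_ge1 : 1 <= p).
Implicit Types f g h : T -> R.

Let p_gt0 : 0 < p. Proof. exact: lt_le_trans p_ge1. Qed.

Lemma Lnorm_nonneg f : (forall t, 0 <= f t) ->
  Lnorm P p%:E (EFin \o f) = ((\int[P]_t (f t `^ p)%:E) `^ p^-1)%E.
Proof.
move=> f0; rewrite unlock; congr (_ `^ _)%E; apply: eq_integral => t _ /=.
by rewrite ger0_norm.
Qed.

Lemma Lnorm_triangle f g h :
  measurable_fun setT f -> measurable_fun setT g -> measurable_fun setT h ->
  (forall t, 0 <= f t) -> (forall t, 0 <= g t) -> (forall t, 0 <= h t) ->
  {ae P, forall t, f t <= g t + h t} ->
  (Lnorm P p%:E (EFin \o f) <= Lnorm P p%:E (EFin \o g) + Lnorm P p%:E (EFin \o h))%E.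
Proof.
move=> mf mg mh f0 g0 h0 fgh.
apply: le_trans (minkowski_EFin _ mg mh p_ge1).
have gh0 t : 0 <= (g \+ h) t by rewrite addr_ge0.
rewrite !Lnorm_nonneg//.
have mpow (k : T -> R) : measurable_fun setT k ->
    measurable_fun setT (EFin \o (fun t => k t `^ p)).
  move=> mk; apply/measurable_EFinP.
  exact: (measurableT_comp (measurable_powR p)).
apply: gt0_ler_poweR.
- by rewrite invr_ge0 ltW.
- by rewrite in_itv/= leey andbT; apply: integral_ge0 => t _; rewrite lee_fin powR_ge0.
- by rewrite in_itv/= leey andbT; apply: integral_ge0 => t _; rewrite lee_fin powR_ge0.
apply: ae_ge0_le_integral => //.
- by move=> t _; rewrite lee_fin powR_ge0.
- exact: mpow.
- by move=> t _; rewrite lee_fin powR_ge0.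
- by apply: mpow; exact: measurable_funD.
apply: filterS fgh => t fgh _.
by rewrite lee_fin ge0_ler_powR ?nnegrE ?addr_ge0// ltW.
Qed.

Lemma Lnorm_cst c : 0 <= c -> Lnorm P p%:E (EFin \o cst c) = c%:E.
Proof.
move=> c0; rewrite Lnorm_nonneg//= integral_cst//.
rewrite [X in (_ * X)%E](_ : _ = 1%E) ?mule1; last exact: probability_setT.
by rewrite poweR_EFin -powRrM mulfV ?gt_eqF// powRr1.
Qed.

End Lnorm.

Section wasserstein.
Context {R : realType} {X : pmetricType R}.
Hypothesis X_compact : compact [set: X].
Variable (p : R) (p_ge1 : 1 <= p).
Implicit Types mu nu rho : probability (borel X) R.

Let p_gt0 : 0 < p. Proof. exact: lt_le_trans p_ge1. Qed.

Let measurable_mdist_pair :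
  measurable_fun setT (fun z : borel (X * X)%type => mdist (z.1 : X) z.2).
Proof.
apply: measurable_mdist => //.
- by apply: (@continuous_measurable_borel (X * X)%type) => z; exact: cvg_fst.
- by apply: (@continuous_measurable_borel (X * X)%type) => z; exact: cvg_snd.
Qed.

Let cost (pi : probability (borel (X * X)%type) R) : \bar R :=
  (\int[pi]_z (mdist (z.1 : X) z.2 `^ p)%:E)%E.

Let cost_ge0 pi : (0 <= cost pi)%E.
Proof. by apply: integral_ge0 => z _; rewrite lee_fin powR_ge0. Qed.

Let measurable_cost :
  measurable_fun setT (fun z : borel (X * X)%type => (mdist (z.1 : X) z.2 `^ p)%:E).
Proof.
apply/measurable_EFinP.
exact: (measurableT_comp (measurable_powR p)) measurable_mdist_pair.
Qed.

(** Allows couplings to be given by two random variables on any probability space; their joint law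
    is carried to the Borel sets of the product topology. *)
Lemma coupling_of_laws d (T : measurableType d) (P : probability T R)
    (x y : T -> X) mu nu :
  measurable_fun setT (x : T -> borel X) ->
  measurable_fun setT (y : T -> borel X) ->
  (forall A : set (borel X), measurable A -> P (x @^-1` A) = mu A) ->
  (forall A : set (borel X), measurable A -> P (y @^-1` A) = nu A) ->
  exists2 pi, coupling mu nu pi &
    cost pi = (\int[P]_t (mdist (x t) (y t) `^ p)%:E)%E.
Proof.
move=> mx my Px Py.
have mxy := measurable_fun_borel_pair X_compact X_compact mx my.
have [pi piE] := probability_pushforward P mxy.
exists pi.
  by move=> A mA; rewrite /pushforward !piE -Px// -Py.
transitivity (\int[pushforward P ((fun t => (x t, y t)) : T -> borel (X * X)%type)]_z
    (mdist (z.1 : X) z.2 `^ p)%:E)%E.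
  by apply: eq_measure_integral => A mA _; rewrite /= piE.
rewrite ge0_integral_pushforward//.
by move=> z _; rewrite lee_fin powR_ge0.
Qed.

Lemma wasserstein_inf_cost mu nu :
  ereal_inf [set cost pi | pi in coupling mu nu] =
    (wasserstein p mu nu `^ p)%:E /\ 0 <= wasserstein p mu nu.
Proof.
rewrite /wasserstein -/(cost _); set I := ereal_inf _.
have I_ge0 : (0 <= I)%E by apply: le_ereal_inf_tmp => _ [pi _ <-]; exact: cost_ge0.
have I_fin : (I < +oo)%E.
  pose PP := (mu \x nu)%E : probability (borel X * borel X)%type R.
  have [||||pi pi_cpl cpi] := @coupling_of_laws _ _ PP fst snd mu nu.
  - exact: measurable_fst.
  - exact: measurable_snd.
  - move=> A mA; rewrite -setXT; rewrite [LHS]product_measure1E//.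
    by rewrite [X in (_ * X)%E](_ : _ = 1%E) ?mule1//; exact: probability_setT.
  - move=> A mA; rewrite -setTX; rewrite [LHS]product_measure1E//.
    by rewrite [X in (X * _)%E](_ : _ = 1%E) ?mul1e//; exact: probability_setT.
  have [M dM] := mdist_bounded X_compact.
  apply: (@le_lt_trans _ _ (cost pi)); first by apply: ereal_inf_lbound; exists pi.
  apply: (@le_lt_trans _ _ (\int[pi]_z (cst (M `^ p)%:E) z)%E).
    apply: ge0_le_integral => //.
    - by move=> z _; rewrite lee_fin powR_ge0.
    - move=> z _; rewrite lee_fin ge0_ler_powR// ?nnegrE ?mdist_ge0//; first exact: ltW.
      exact: le_trans (mdist_ge0 (point : X) point) (dM _ _).
  rewrite integral_cst// [X in (_ * X)%E](_ : _ = 1%E) ?mule1 ?ltry//.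
  exact: probability_setT.
move: I I_ge0 I_fin => [i|//|//]; rewrite lee_fin => i0 _.
rewrite poweR_EFin /= powR_ge0 -powRrM mulVf ?gt_eqF//.
by rewrite powRr1.
Qed.

Lemma wasserstein_le_Lnorm d (T : measurableType d) (P : probability T R)
    (x y : T -> X) mu nu :
  measurable_fun setT (x : T -> borel X) ->
  measurable_fun setT (y : T -> borel X) ->
  (forall A : set (borel X), measurable A -> P (x @^-1` A) = mu A) ->
  (forall A : set (borel X), measurable A -> P (y @^-1` A) = nu A) ->
  ((wasserstein p mu nu)%:E <=
     Lnorm P p%:E (EFin \o (fun t => mdist (x t) (y t))))%E.
Proof.
move=> mx my Px Py.
have [pi pi_cpl cpi] := coupling_of_laws mx my Px Py.
rewrite Lnorm_nonneg -?cpi; last by move=> t; exact: mdist_ge0.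
have [I_E W_ge0] := wasserstein_inf_cost mu nu.
have -> : (wasserstein p mu nu)%:E = ((wasserstein p mu nu `^ p)%:E `^ p^-1)%E.
  by rewrite poweR_EFin -powRrM mulfV ?gt_eqF// powRr1.
apply: gt0_ler_poweR => //.
- by rewrite invr_ge0 ltW.
- by rewrite in_itv/= leey andbT lee_fin powR_ge0.
- by rewrite in_itv/= leey andbT; exact: cost_ge0.
- by rewrite -I_E; apply: ereal_inf_lbound; exists pi.
Qed.

(** Optimality up to e suffices, since the triangle and distortion inequalities are proved up to an
    arbitrary error. *)
Lemma wasserstein_coupling mu nu (e : R) : 0 < e ->
  exists2 pi : probability (borel (X * X)%type) R, coupling mu nu pi &
    (Lnorm pi p%:E (EFin \o (fun z : X * X => mdist z.1 z.2)) <=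
       (wasserstein p mu nu + e)%:E)%E.
Proof.
move=> e0.
have [I_E W_ge0] := wasserstein_inf_cost mu nu.
have : (ereal_inf [set cost pi | pi in coupling mu nu] <
    ((wasserstein p mu nu + e) `^ p)%:E)%E.
  rewrite I_E lte_fin gt0_ltr_powR ?nnegrE//; lra.
move=> /ereal_inf_lt[_ [pi pi_cpl <-] /ltW cpi]; exists pi => //.
rewrite Lnorm_nonneg; last by move=> z; exact: mdist_ge0.
have -> : (wasserstein p mu nu + e)%:E =
    (((wasserstein p mu nu + e) `^ p)%:E `^ p^-1)%E.
  rewrite poweR_EFin -powRrM mulfV ?gt_eqF// powRr1//; lra.
apply: gt0_ler_poweR => //.
- by rewrite invr_ge0 ltW.
- by rewrite in_itv/= leey andbT; exact: cost_ge0.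
- by rewrite in_itv/= leey andbT lee_fin powR_ge0.
Qed.

End wasserstein.

Lemma Lnorm_pushforward (R : realType) d1 d2 (S : measurableType d1)
    (T : measurableType d2) (P : probability S R) (Q : probability T R)
    (f : S -> T) (g : T -> R) (p : R) :
  measurable_fun setT f -> (forall B, measurable B -> P (f @^-1` B) = Q B) ->
  measurable_fun setT g -> (forall t, 0 <= g t) ->
  Lnorm P p%:E (EFin \o (g \o f)) = Lnorm Q p%:E (EFin \o g).
Proof.
move=> mf PQ mg g0.
rewrite !Lnorm_nonneg//; last by move=> s; exact: g0.
congr (_ `^ _)%E.
transitivity (\int[pushforward P f]_t (g t `^ p)%:E)%E; last first.
  by apply: eq_measure_integral => A mA _; exact: PQ.
rewrite ge0_integral_pushforward//.
- apply/measurable_EFinP.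
  exact: (measurableT_comp (measurable_powR p)).
- by move=> t _; rewrite lee_fin powR_ge0.
Qed.

(** The coupling is given by random variables on an arbitrary space, so that exchanging X and Y only
    swaps the two maps, and such spaces can be glued to one another directly. *)
Definition coupled_in (R : realType) (X Y : pmetricType R) (E : X -> Y -> Prop)
    (mu : probability (borel X) R) (nu : probability (borel Y) R) :=
  exists d (T : measurableType d) (P : probability T R) (x : T -> X) (y : T -> Y),
    [/\ measurable_fun setT (x : T -> borel X),
        measurable_fun setT (y : T -> borel Y),
        forall A : set (borel X), measurable A -> P (x @^-1` A) = mu A,
        forall A : set (borel Y), measurable A -> P (y @^-1` A) = nu A &
        {ae P, forall t, E (x t) (y t)}].

Lemma coupled_in_sym (R : realType) (X Y : pmetricType R) (E : X -> Y -> Prop) mu nu :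
  coupled_in E mu nu -> coupled_in (fun y x => E x y) nu mu.
Proof. by move=> [d [T [P [x [y [mx my Px Py PE]]]]]]; exists d, T, P, y, x. Qed.

Lemma coupling_coupled_in (R : realType) (X : pmetricType R)
    (mu nu : probability (borel X) R) pi :
  coupling mu nu pi ->
  [/\ measurable_fun setT (fst : borel (X * X)%type -> borel X),
      measurable_fun setT (snd : borel (X * X)%type -> borel X),
      forall A : set (borel X), measurable A -> pi (fst @^-1` A) = mu A &
      forall A : set (borel X), measurable A -> pi (snd @^-1` A) = nu A].
Proof.
move=> cpl; split.
- by apply: (@continuous_measurable_borel (X * X)%type) => z; exact: cvg_fst.
- by apply: (@continuous_measurable_borel (X * X)%type) => z; exact: cvg_snd.
- by move=> A mA; have [] := cpl A mA.
- by move=> A mA; have [] := cpl A mA.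
Qed.

Section pseudometric.
Context {R : realType} {X : pmetricType R}.
Hypothesis X_compact : compact [set: X].
Variable (p : R) (p_ge1 : 1 <= p).
Implicit Types mu nu rho : probability (borel X) R.

Lemma wasserstein_ge0 mu nu : 0 <= wasserstein p mu nu.
Proof. by have [] := wasserstein_inf_cost X_compact p_ge1 mu nu. Qed.

Lemma wassersteinxx mu : wasserstein p mu mu = 0.
Proof.
apply/eqP; rewrite eq_le wasserstein_ge0 andbT -lee_fin.
apply: le_trans
  (@wasserstein_le_Lnorm _ _ X_compact _ p_ge1 _ _ mu id id mu mu _ _ _ _) _ => //.
rewrite [X in Lnorm _ _ X](_ : _ = EFin \o cst 0); first by rewrite Lnorm_cst.
by apply/funext => x /=; rewrite mdistxx.
Qed.

Lemma wasserstein_sym mu nu : wasserstein p mu nu = wasserstein p nu mu.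
Proof.
suff H mu' nu' : wasserstein p mu' nu' <= wasserstein p nu' mu'.
  by apply/eqP; rewrite eq_le !H.
apply/ler_addgt0Pr => e e0.
have [pi /coupling_coupled_in[m1 m2 pi1 pi2] cpi] :=
  wasserstein_coupling X_compact p_ge1 nu' mu' e0.
rewrite -lee_fin (le_trans _ cpi)//.
apply: le_trans (wasserstein_le_Lnorm X_compact p_ge1 m2 m1 pi2 pi1) _.
rewrite [X in (Lnorm _ _ X <= _)%E](_ : _ =
  (EFin \o (fun z : X * X => mdist z.1 z.2)))//.
by apply/funext => z /=; rewrite metric_sym.
Qed.

(** Two nearly optimal couplings are glued along [nu], so their middle points are only [e / 3]
    apart. Minkowski's inequality is applied to the path through both of them; the other two thirds
    of e pay for near-optimality. *)
Lemma wasserstein_triangle mu nu rho :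
  wasserstein p mu rho <= wasserstein p mu nu + wasserstein p nu rho.
Proof.
apply/ler_addgt0Pr => e e0; have e3 : 0 < e / 3 by lra.
have [pi1 /coupling_coupled_in[mx mf1 Px Pf1] c1] :=
  wasserstein_coupling X_compact p_ge1 mu nu e3.
have [pi2 /coupling_coupled_in[mf2 my Pf2 Py] c2] :=
  wasserstein_coupling X_compact p_ge1 nu rho e3.
have f12 (A : set (borel X)) : measurable A -> pi1 (snd @^-1` A) = pi2 (fst @^-1` A).
  by move=> mA; rewrite Pf1// Pf2.
have [Q [Q1 Q2 Qd]] := approximate_gluing X_compact mf1 mf2 f12 e3.
have mfst := @measurable_fst _ _ (borel (X * X)%type) (borel (X * X)%type).
have msnd := @measurable_snd _ _ (borel (X * X)%type) (borel (X * X)%type).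
pose x : borel (X * X)%type * borel (X * X)%type -> X := fun z => z.1.1.
pose y : borel (X * X)%type * borel (X * X)%type -> X := fun z => z.2.2.
have mQx : measurable_fun setT (x : _ -> borel X) by exact: measurableT_comp mx mfst.
have mQy : measurable_fun setT (y : _ -> borel X) by exact: measurableT_comp my msnd.
have Qx (A : set (borel X)) : measurable A -> Q (x @^-1` A) = mu A.
  by move=> mA; rewrite -Px// -Q1//; exact: measurable_preimage.
have Qy (A : set (borel X)) : measurable A -> Q (y @^-1` A) = rho A.
  by move=> mA; rewrite -Py// -Q2//; exact: measurable_preimage.
pose dist z := mdist (z.1 : X) z.2.
have mdist1 : measurable_fun setT (dist : borel (X * X)%type -> R).
  exact: measurable_mdist.
have dist_ge0 z : 0 <= dist z by exact: mdist_ge0.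
have mc : measurable_fun setT
    (cst (e / 3) : borel (X * X)%type * borel (X * X)%type -> R).
  exact: measurable_cst.
have md1 := measurableT_comp mdist1 mfst.
have md2 := measurableT_comp mdist1 msnd.
have md2c := measurable_funD md2 mc.
rewrite -lee_fin; apply: le_trans
  (wasserstein_le_Lnorm X_compact p_ge1 mQx mQy Qx Qy) _.
apply: le_trans (Lnorm_triangle p_ge1 _ md1 md2c _ _ _ _) _.
- exact: measurable_mdist.
- by move=> z; exact: mdist_ge0.
- by move=> z; exact: dist_ge0.
- by move=> z /=; rewrite addr_ge0// ltW.
- apply: filterS Qd => z /= zd.
  rewrite /x /y /dist.
  have := metric_triangle z.1.1 z.1.2 z.2.2.
  have := metric_triangle z.1.2 z.2.1 z.2.2; lra.
have Qg (f : _ -> borel (X * X)%type) (pi : probability (borel (X * X)%type) R) :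
    measurable_fun setT f ->
    (forall B, measurable B -> Q (f @^-1` B) = pi B) ->
    Lnorm Q p%:E (EFin \o (dist \o f)) = Lnorm pi p%:E (EFin \o dist).
  by move=> mf Qf; exact: Lnorm_pushforward.
rewrite (Qg _ pi1)//.
apply: (@le_trans _ _ ((wasserstein p mu nu + e / 3)%:E +
    ((wasserstein p nu rho + e / 3)%:E + (e / 3)%:E))%E); last first.
  rewrite -!EFinD lee_fin; lra.
apply: leeD; first exact: c1.
apply: (@le_trans _ _ (Lnorm pi2 p%:E (EFin \o dist) + (e / 3)%:E)%E); last exact: leeD.
rewrite -(Qg _ pi2 msnd Q2) -[X in (_ + X)%E](Lnorm_cst Q p_ge1 (ltW e3)).
apply: Lnorm_triangle => //.
- by move=> z /=; rewrite addr_ge0// ltW.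
- by move=> z; exact: dist_ge0.
- by move=> z /=; exact: ltW.
- by apply: aeW => z; exact: lexx.
Qed.

End pseudometric.

(** A nearly optimal coupling of [mu1] and [mu2] is glued on one side to the space carrying
    [(x1, y1)], on the other to that carrying [(x2, y2)]. On the resulting space the distance from
    [y1] to [y2] exceeds that of the coupled points by at most s and two gluing errors, whose sum is
    [c']. *)
Lemma wasserstein_distortion (R : realType) (X Y : pmetricType R)
    (E : X -> Y -> Prop) (s p : R) (mu1 mu2 : probability (borel X) R)
    (nu1 nu2 : probability (borel Y) R) :
  compact [set: X] -> compact [set: Y] -> 1 <= p -> 0 <= s ->
  (forall x1 y1 x2 y2, E x1 y1 -> E x2 y2 -> mdist y1 y2 <= mdist x1 x2 + s) ->
  coupled_in E mu1 nu1 -> coupled_in E mu2 nu2 ->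
  wasserstein p nu1 nu2 <= wasserstein p mu1 mu2 + s.
Proof.
move=> cX cY p_ge1 s_ge0 Es.
move=> [d1 [S1 [P1 [x1 [y1 [mx1 my1 Px1 Py1 PE1]]]]]].
move=> [d2 [S2 [P2 [x2 [y2 [mx2 my2 Px2 Py2 PE2]]]]]].
apply/ler_addgt0Pr => e e0; have e3 : 0 < e / 3 by lra.
have [pi /coupling_coupled_in[mf mg Pf Pg] c] :=
  wasserstein_coupling cX p_ge1 mu1 mu2 e3.
have x1f (A : set (borel X)) : measurable A -> P1 (x1 @^-1` A) = pi (fst @^-1` A).
  by move=> mA; rewrite Px1// Pf.
have [Q [Q1 Q2 Qd]] := approximate_gluing cX mx1 mf x1f e3.
have mfst1 := @measurable_fst _ _ S1 (borel (X * X)%type).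
have msnd1 := @measurable_snd _ _ S1 (borel (X * X)%type).
pose g' : S1 * borel (X * X)%type -> X := fun z => z.2.2.
have mg' : measurable_fun setT (g' : _ -> borel X) by exact: measurableT_comp mg msnd1.
have g'x2 (A : set (borel X)) : measurable A -> Q (g' @^-1` A) = P2 (x2 @^-1` A).
  move=> mA; rewrite Px2// -Pg// -Q2//; exact: measurable_preimage.
have [Q' [Q'1 Q'2 Q'd]] := approximate_gluing cX mg' mx2 g'x2 e3.
have mfst := @measurable_fst _ _ (S1 * borel (X * X)%type)%type S2.
have msnd := @measurable_snd _ _ (S1 * borel (X * X)%type)%type S2.
pose u : (S1 * borel (X * X)%type) * S2 -> Y := fun z => y1 z.1.1.
pose v : (S1 * borel (X * X)%type) * S2 -> Y := fun z => y2 z.2.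
have mu_ : measurable_fun setT (u : _ -> borel Y).
  exact: measurableT_comp my1 (measurableT_comp mfst1 mfst).
have mv : measurable_fun setT (v : _ -> borel Y) by exact: measurableT_comp my2 msnd.
have Q'u (A : set (borel Y)) : measurable A -> Q' (u @^-1` A) = nu1 A.
  move=> mA; have mA1 := measurable_preimage my1 mA.
  by rewrite -Py1// -Q1// -Q'1//; exact: measurable_preimage mfst1 mA1.
have Q'v (A : set (borel Y)) : measurable A -> Q' (v @^-1` A) = nu2 A.
  by move=> mA; rewrite -Py2// -Q'2//; exact: measurable_preimage my2 mA.
pose dist z := mdist (z.1 : X) z.2.
have dist_ge0 z : 0 <= dist z by exact: mdist_ge0.
have mdist1 : measurable_fun setT (dist : borel (X * X)%type -> R).
  exact: measurable_mdist.
have mmid := measurableT_comp msnd1 mfst.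
have md := measurableT_comp mdist1 mmid.
pose c' := e / 3 + e / 3 + s.
have c'0 : 0 <= c' by rewrite /c'; lra.
have mc : measurable_fun setT (cst c' : (S1 * borel (X * X)%type) * S2 -> R).
  exact: measurable_cst.
rewrite -lee_fin; apply: le_trans
  (wasserstein_le_Lnorm cY p_ge1 mu_ mv Q'u Q'v) _.
have Qmid B : measurable B -> Q' ((snd \o fst) @^-1` B) = pi B.
  by move=> mB; rewrite -Q2// -Q'1//; exact: measurable_preimage msnd1 mB.
apply: (@le_trans _ _ (Lnorm pi p%:E (EFin \o dist) + c'%:E)%E); last first.
  by apply: le_trans (leeD c (lexx _)) _; rewrite -EFinD lee_fin /c'; lra.
rewrite -(Lnorm_pushforward p mmid Qmid mdist1 dist_ge0).
rewrite -[X in (_ + X)%E](Lnorm_cst Q' p_ge1 c'0).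
apply: Lnorm_triangle => //.
- exact: measurable_mdist.
- by move=> z; exact: mdist_ge0.
- by move=> z; exact: dist_ge0.
- have AE1 : {ae Q', forall z, E (x1 z.1.1) (y1 z.1.1)}.
    apply: (@ae_pushforward _ _ _ _ _ Q' Q fst (fun z => E (x1 z.1) (y1 z.1))) => //.
    exact: (@ae_pushforward _ _ _ _ _ Q P1 fst (fun z => E (x1 z) (y1 z))).
  have AE2 : {ae Q', forall z, E (x2 z.2) (y2 z.2)}.
    exact: (@ae_pushforward _ _ _ _ _ Q' P2 snd (fun z => E (x2 z) (y2 z))).
  have AE3 : {ae Q', forall z, mdist (x1 z.1.1) z.1.2.1 <= e / 3}.
    exact: (@ae_pushforward _ _ _ _ _ Q' Q fst
      (fun z => mdist (x1 z.1) z.2.1 <= e / 3)).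
  have FQ' := ae_filter_ringOfSetsType Q'.
  apply: filterS (filterI AE1 (filterI AE2 (filterI AE3 Q'd))).
  move=> z [z1 [z2 [z3 /= z4]]].
  have := Es _ _ _ _ z1 z2.
  have := metric_triangle (x1 z.1.1) z.1.2.1 (x2 z.2).
  have := metric_triangle z.1.2.1 z.1.2.2 (x2 z.2).
  move: z4; rewrite /u /v /g' /dist /c'; lra.
Qed.

(** * Gromov-Hausdorff distance and correspondences *)

(** In a [metricType] points at distance 0 are equal, so T is replaced by its quotient, realized as
    the type of those subsets of T that are classes. *)
Lemma pseudometric_realization (R : realType) (T : Type) (D : T -> T -> R) :
  (forall x, D x x = 0) -> (forall x y, D x y = D y x) ->
  (forall y x z, D x z <= D x y + D y z) ->
  exists (Z : metricType R) (f : T -> Z), forall x y, mdist (f x) (f y) = D x y.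
Proof.
move=> Dxx Dsym Dtri.
have D0l x y z : D x y = 0 -> D x z = D y z.
  move=> xy; apply/eqP; rewrite eq_le.
  have := Dtri y x z; have := Dtri x y z; rewrite (Dsym y x) xy.
  by rewrite !add0r => -> ->.
pose cls x := [set y | D x y = 0].
pose Z0 := {A : set T | exists x, A = cls x}.
pose rep (z : Z0) : T := projT1 (cid (svalP z)).
have repE z : sval z = cls (rep z) := projT2 (cid (svalP z)).
pose f x : Z0 := exist _ (cls x) (ex_intro _ x erefl).
have fE x : D (rep (f x)) x = 0.
  suff : cls (rep (f x)) x by [].
  by rewrite -repE.
pose dZ z z' := D (rep z) (rep z').
have dZxx z : dZ z z = 0 by exact: Dxx.
have dZ_pos z z' : dZ z z' = 0 -> z = z'.
  have svalI (u v : Z0) : sval u = sval v -> u = v.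
    by move: u v => [A hA] [B hB] /=; exact: eq_exist.
  move=> zz'; apply: svalI; rewrite !repE.
  by apply/seteqP; split=> y /=; rewrite /cls/= (D0l _ _ _ zz').
have dZ_sym z z' : dZ z z' = dZ z' z by exact: Dsym.
have dZ_tri z' z z'' : dZ z z'' <= dZ z z' + dZ z' z'' by exact: Dtri.
pose Z1 : choiceType := HB.pack Z0 (gen_eqMixin Z0) (gen_choiceMixin Z0).
pose Z : metricType R :=
  HB.pack Z0 Z1 (isMetric.Build R Z1 dZxx dZ_pos dZ_sym dZ_tri).
exists Z, f => x y; rewrite -[LHS]/(dZ (f x) (f y)) /dZ.
by rewrite (D0l _ _ _ (fE x)) Dsym (D0l _ _ _ (fE y)).
Qed.

(** The two spaces are joined in their disjoint union: going from x to y means moving to some a,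
    jumping to a related b at cost [e / 2], then moving to y. Related points end up at distance at
    most [e / 2], hence below e as the strict inequality in [hausdorff_distance] requires. *)
Lemma gromov_hausdorff_le (R : realType) (T1 T2 : Type) (d1 : T1 -> T1 -> R)
    (d2 : T2 -> T2 -> R) (rel : T1 -> T2 -> Prop) (e : R) :
  (forall x, d1 x x = 0) -> (forall x y, d1 x y = d1 y x) ->
  (forall y x z, d1 x z <= d1 x y + d1 y z) ->
  (forall x, d2 x x = 0) -> (forall x y, d2 x y = d2 y x) ->
  (forall y x z, d2 x z <= d2 x y + d2 y z) ->
  0 < e ->
  (forall x, exists y, rel x y) -> (forall y, exists x, rel x y) ->
  (forall x y x' y', rel x y -> rel x' y' -> `|d1 x x' - d2 y y'| <= e) ->
  (gromov_hausdorff d1 d2 <= e%:E)%E.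
Proof.
move=> d1xx d1sym d1tri d2xx d2sym d2tri e0 rel1 rel2 rel_e.
have d1_ge0 x y : 0 <= d1 x y.
  by have := d1tri y x x; rewrite d1xx (d1sym y x); lra.
have d2_ge0 x y : 0 <= d2 x y.
  by have := d2tri y x x; rewrite d2xx (d2sym y x); lra.
pose S x y := [set d1 x ab.1 + e / 2 + d2 ab.2 y | ab in [set ab | rel ab.1 ab.2]].
pose c x y := inf (S x y).
have S0 x y : S x y !=set0.
  by have [b xb] := rel1 x; exists (d1 x x + e / 2 + d2 b y), (x, b).
have Slb x y : has_inf (S x y).
  split=> //; exists 0 => _ [[a b] /= _ <-].
  by rewrite !addr_ge0// divr_ge0// ltW.
have c_le x y a b : rel a b -> c x y <= d1 x a + e / 2 + d2 b y.
  by move=> ab; apply: ge_inf; [exact: (Slb x y).2|exists (a, b)].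
have c_ge x y r : (forall a b, rel a b -> r <= d1 x a + e / 2 + d2 b y) -> r <= c x y.
  by move=> rab; apply: lb_le_inf => // _ [[a b] /= ab <-]; exact: rab.
pose D (u v : T1 + T2) := match u, v with
  | inl x, inl y => d1 x y
  | inr x, inr y => d2 x y
  | inl x, inr y => c x y
  | inr y, inl x => c x y
  end.
have Dxx u : D u u = 0 by case: u => x /=.
have Dsym u v : D u v = D v u by case: u; case: v => //=.
have Dtri v u w : D u w <= D u v + D v w.
  case: u => [x|x]; case: v => [y|y]; case: w => [z|z] //=.
  - rewrite -lerBlDl; apply: (c_ge) => a b ab.
    by have := c_le x z _ _ ab; have := d1tri y x a; lra.
  (* A path that leaves and comes back jumps twice and pays e in total, which compensates the
     distortion of the relation. *)
  - rewrite -lerBlDr; apply: (c_ge) => a b ab; rewrite lerBlDr -lerBlDl.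
    apply: (c_ge) => a' b' ab'.
    have := rel_e _ _ _ _ ab ab'; rewrite ler_norml => /andP[_].
    have := d2tri y b b'; rewrite (d2sym y b').
    have := d1tri a x z; have := d1tri a' a z; rewrite (d1sym a' z); lra.
  - rewrite -lerBlDr; apply: (c_ge) => a b ab.
    by have := c_le x z _ _ ab; have := d2tri y b z; lra.
  - rewrite -lerBlDr; apply: (c_ge) => a b ab.
    by have := c_le z x _ _ ab; have := d1tri y z a; rewrite (d1sym z y); lra.
  - rewrite -lerBlDr; apply: (c_ge) => a b ab; rewrite lerBlDr -lerBlDl.
    apply: (c_ge) => a' b' ab'.
    have := rel_e _ _ _ _ ab ab'; rewrite ler_norml => /andP[+ _].
    have := d1tri y a a'; rewrite (d1sym a y).
    have := d2tri b x z; have := d2tri b' b z; rewrite (d2sym x b); lra.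
  - rewrite -lerBlDl; apply: (c_ge) => a b ab.
    by have := c_le z x _ _ ab; have := d2tri y b x; rewrite (d2sym y x); lra.
have [Z [f fD]] := pseudometric_realization Dxx Dsym Dtri.
have fc x y : rel x y -> mdist (f (inl x)) (f (inr y)) < e.
  move=> xy; rewrite fD /=; have := c_le x y _ _ xy.
  by rewrite d1xx d2xx; lra.
apply: (@le_trans _ _ (hausdorff_distance (range (f \o inl)) (range (f \o inr)))).
  apply: ereal_inf_lbound; exists Z, (f \o inl), (f \o inr).
  by split=> // x y; rewrite fD.
apply: ereal_inf_lbound; exists e => //; split=> //.
- move=> _ [x _ <-]; have [y xy] := rel1 x.
  by exists (f (inr y)); [exists y|exact: fc].
- move=> _ [y _ <-]; have [x xy] := rel2 y.
  by exists (f (inl x)); [exists x|exact: fc].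
Qed.

(** * Averaging over Folner sets *)

Lemma mulg_continuous_l (G : topologicalGroupType) (h : G) :
  continuous (fun g : G => (h * g)%g).
Proof.
move=> g; apply: (@continuous_comp _ _ _ (fun g => (h, g))
  (fun xy : G * G => (xy.1 * xy.2)%g)).
  by apply: cvg_pair => //; exact: cvg_cst.
exact: mulg_continuous.
Qed.

Lemma ltranslate_preimage (G : topologicalGroupType) (h : G) (A : set G) :
  ltranslate h A = (fun g => (h^-1 * g)%g) @^-1` A.
Proof.
apply/seteqP; split=> [_ [g Ag <-]|g /= Ag]; first by rewrite /= mulKg.
by exists (h^-1 * g)%g => //; rewrite mulVKg.
Qed.

Lemma measurable_mulg_preimage (G : topologicalGroupType) (h : G)
    (A : set (borel G)) :
  measurable A -> measurable ((fun g => (h * g)%g) @^-1` A : set (borel G)).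
Proof.
have mh := continuous_measurable_borel (@mulg_continuous_l G h).
by move=> mA; apply (measurable_preimage mh mA).
Qed.

(** m is Haar measure conditioned on a Folner set F. Translating by h turns the left side into the
    measure of a part of A inside [ltranslate h F], which differs from F by at most [e * q]. *)
Lemma amenable_probability (R : realType) (G : topologicalGroupType) (K : set G)
    (e : R) : amenable R G -> compact K -> 0 < e ->
  exists m : probability (borel G) R, forall h (A : set (borel G)), K h ->
    measurable A -> (m ((fun g => (h * g)%g) @^-1` A) <= m A + e%:E)%E.
Proof.
move=> [lambda [_ lambdaM _ _ _]] /[apply] /[apply].
move=> [F [mF F_gt0 F_fin FK]].
have F_fin_num : lambda F \is a fin_num by rewrite ge0_fin_numE.
pose q := fine (lambda F).
have q_gt0 : 0 < q by apply: fine_gt0; rewrite F_gt0.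
(* The default [dirac point] is never reached, as F has positive finite measure. *)
pose m : probability (borel G) R := mnormalize (mrestr lambda mF) (dirac point).
have mE A : m A = (lambda (A `&` F) * (q^-1)%:E)%E.
  rewrite /m /= /mnormalize /= /mrestr setTI ifF//.
  by apply/negbTE; rewrite negb_or gt_eqF//= lt_eqF.
exists m => h A Kh mA.
have mtrans (B : set (borel G)) :
    measurable B -> measurable (ltranslate h B : set (borel G)).
  by move=> mB; rewrite ltranslate_preimage; exact: measurable_mulg_preimage.
have mhA := measurable_mulg_preimage h mA.
have mY : measurable (ltranslate h F `+` F : set (borel G)).
  by apply: measurableU; apply: measurableD => //; exact: mtrans.
have mAF B : measurable B -> measurable (B `&` F : set (borel G)).
  by move=> mB; exact: measurableI.
have Y_le : (lambda (ltranslate h F `+` F) <= (e * q)%:E)%E.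
  have := FK h Kh; rewrite -(fineK F_fin_num) -/q inver gt_eqF//.
  by rewrite lte_pdivrMr// => /ltW; rewrite EFinM.
have hAF_le : (lambda ((fun g => (h * g)%g) @^-1` A `&` F) <=
    lambda (A `&` F) + (e * q)%:E)%E.
  rewrite -(lambdaM h); last exact: mAF.
  apply: le_trans (leeD (lexx _) Y_le).
  apply: (@le_trans _ _ (lambda ((A `&` F) `|` (ltranslate h F `+` F)))); last first.
    by apply: measureU2 => //; exact: mAF.
  apply: le_measure; rewrite ?inE.
  - by apply: mtrans; exact: mAF.
  - by apply: measurableU => //; exact: mAF.
  - move=> _ [g [/= hgA Fg] <-]; have [Fhg|Fhg] := pselect (F (h * g)%g); [left|right].
      by [].
    by left; split=> //; exists g.
rewrite !mE.
apply: le_trans (lee_wpmul2r _ hAF_le) _.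
  by rewrite lee_fin invr_ge0 ltW.
have : lambda (A `&` F) \is a fin_num.
  rewrite ge0_fin_numE//; apply: le_lt_trans F_fin.
  by apply: le_measure; rewrite ?inE//; exact: mAF.
case: (lambda (A `&` F)) => // a _.
by rewrite -EFinD -!EFinM -EFinD lee_fin mulrDl mulfK ?gt_eqF.
Qed.

(* As G need not be second countable, joint continuity would only give Borel
   measurability on X * G, not measurability for the product sigma-algebra. *)
Section joint_measurability.
Context {R : realType} {X Z : pmetricType R} {G : ptopologicalType}.
Hypothesis X_compact : compact [set: X].

Lemma measurable_colored (c : X -> nat) (f : nat -> G -> Z) :
  (forall k, measurable (c @^-1` [set k] : set (borel X))) ->
  (forall k, continuous (f k)) ->
  measurable_fun setT
    ((fun xg => f (c xg.1) xg.2) : borel X * borel G -> borel Z).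
Proof.
move=> mc cf; apply: measurable_fun_borel => U oU.
rewrite (_ : _ @^-1` _ = \bigcup_k ((c @^-1` [set k] : set (borel X)) `*`
    (f k @^-1` U : set (borel G)))).
  apply: bigcupT_measurable => k; apply: measurableX => //.
  by apply: open_borel; apply: open_comp => // g _; exact: cf.
apply/seteqP; split=> [[x g] /= fU|[x g] [k _ [/= <-]]//].
by exists (c x).
Qed.

(** Replacing x by a representative of its cell gives jointly measurable maps that converge
    uniformly to f. *)
Lemma measurable_lipschitz_continuous (f : X -> G -> Z) :
  (forall g x x', mdist (f x g) (f x' g) <= mdist x x') ->
  (forall x, continuous (f x)) ->
  measurable_fun setT ((fun xg => f xg.1 xg.2) : borel X * borel G -> borel Z).
Proof.
move=> lf cf; apply: measurable_fun_borel => U oU.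
pose d n : R := n.+1%:R^-1.
have d_gt0 n : 0 < d n by rewrite invr_gt0.
have colP n : exists c : X -> nat,
    (forall k, measurable (c @^-1` [set k] : set (borel X))) /\
    forall x y, c x = c y -> mdist x y <= d n.
  by have [N [c [_ mc cd]]] := finite_borel_coloring X_compact (d_gt0 n); exists c.
have [c cP] := choice colP.
have repP n : exists r : nat -> X, forall x, c n (r (c n x)) = c n x.
  have /choice[r rP] (k : nat) : exists y : X, (exists x, c n x = k) -> c n y = k.
    have [[x xk]|nk] := pselect (exists x, c n x = k); first by exists x.
    by exists point => /nk.
  by exists r => x; apply: rP; exists x.
have [r rP] := choice repP.
have rd n x : mdist x (r n (c n x)) <= d n by apply: (cP n).2.
(* The approximation is within [d n] of f. If it falls in [W n], then f is within [3 * d n] of the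
   centre, hence in U; conversely, once a ball of radius [3 * d n] around the value of f fits in U,
   that value serves as the centre. *)
pose W n := \bigcup_(a in [set a | ball a (3 * d n) `<=` U]) ball a (2 * d n).
have oW n : open (W n) by apply: bigcup_open => a _; exact: open_ball_mdist.
rewrite (_ : _ @^-1` _ = \bigcup_n
    ((fun xg => f (r n (c n xg.1)) xg.2) @^-1` W n)).
  apply: bigcupT_measurable => n.
  have mc := measurable_colored (cP n).1 (fun k => cf (r n k)).
  apply: (measurable_preimage mc); exact: open_borel.
apply/seteqP; split=> [[x g] /= fU|[x g] [n _ /= [a aU /ball_mdistP aW]]]; last first.
  apply: aU; apply/ball_mdistP.
  have := lf g (r n (c n x)) x; have := rd n x; rewrite (metric_sym x).
  have := metric_triangle a (f (r n (c n x)) g) (f x g); lra.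
have /nbhs_ballP[e /= e0 eU] := open_nbhs_nbhs (conj oU fU).
have e3 : 0 < e / 3 by lra.
have [n _ ne] : \forall n \near \oo, d n < e / 3.
  exact: near_infty_natSinv_lt (PosNum e3).
have {}ne : d n < e / 3 := ne n (leqnn n).
exists n => //=; exists (f x g).
  move=> z /ball_mdistP zd; apply: eU; apply/ball_mdistP; lra.
apply/ball_mdistP; have := lf g x (r n (c n x)).
by have := rd n x; have := d_gt0 n; lra.
Qed.

End joint_measurability.

(** * Cluster points of probability measures *)

(* The limit along an ultrafilter is only finitely additive; P is the measure
   that [content_probability] attaches to it. *)
Lemma cluster_probability (R : realType) (Z : ptopologicalType) (M : Type)
    (xi : M -> probability (borel Z) R) (F : set_system M) :
  ProperFilter F -> hausdorff_space Z -> compact [set: Z] ->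
  exists P : probability (borel Z) R,
    (forall (U : set Z) (r : R), open U ->
       (forall C, closed C -> C `<=` U -> \forall m \near F, (xi m C <= r%:E)%E) ->
       (P U <= r%:E)%E) /\
    (forall U V : set Z, open U -> open V ->
       (forall C, closed C -> C `<=` U -> exists C', [/\ closed C', C' `<=` V &
          forall e : R, 0 < e -> \forall m \near F, (xi m C <= xi m C' + e%:E)%E]) ->
       (P U <= P V)%E).
Proof.
move=> FF hZ cZ.
have [G [UG FG]] := ultraFilterLemma FF.
have PG : ProperFilter G by exact: ultra_proper.
pose u A m := fine (xi m A).
have xiE A m : measurable A -> xi m A = (u A m)%:E.
  by move=> mA; rewrite fineK// fin_num_measure.
have u01 A m : measurable A -> 0 <= u A m <= 1.
  move=> mA; rewrite -!lee_fin -xiE// probability_le1// andbT.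
  exact: measure_ge0.
have wP A : exists l : R, closed A -> u A m @[m --> G] --> l.
  have [cA|nA] := pselect (closed A); last by exists 0.
  have u01G : (u A @ G) `[0, 1]%classic.
    by apply: nearW => m; rewrite /= in_itv/= u01//; exact: closed_borel.
  have [l [_ ul]] := @segment_compact R 0 1 (u A @ G) _ u01G.
  (* A cluster point of an ultrafilter is a limit: otherwise the complement of a neighbourhood would
     belong to the ultrafilter. *)
  exists l => _ N Nl; have [//|GN] := in_ultra_setVsetC (u A @^-1` N) UG.
  by have [x []] := ul (~` N) N GN Nl.
have [w wE] := choice wP.
have w_le A B e : closed A -> closed B -> (\forall m \near G, u A m <= u B m + e) ->
    w A <= w B + e.
  move=> cA cB AB; have uB : u B m + e @[m --> G] --> w B + e.
    by apply: cvgD; [exact: wE|exact: cvg_cst].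
  rewrite -subr_ge0; apply: cvgr_to_ge (cvgB uB (wE A cA)) _.
  by apply: filterS AB => m; rewrite subr_ge0.
have w_le0 A B : closed A -> closed B -> (forall m, (xi m A <= xi m B)%E) -> w A <= w B.
  move=> cA cB AB; rewrite -[w B]addr0; apply: w_le => //; apply: nearW => m.
  by rewrite addr0 -lee_fin -!xiE//; exact: closed_borel.
have w_homo A B : closed A -> closed B -> A `<=` B -> w A <= w B.
  move=> cA cB AB; apply: w_le0 => // m.
  by apply: le_measure; rewrite ?inE//; exact: closed_borel.
have w_add A B : closed A -> closed B -> A `&` B = set0 -> w (A `|` B) = w A + w B.
  move=> cA cB AB; have cAB : closed (A `|` B) by exact: closedU.
  apply: cvg_unique (wE _ cAB) _ => //.
  rewrite (_ : u (A `|` B) = (fun m => u A m + u B m)).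
    exact: cvgD (wE A cA) (wE B cB).
  apply/funext => m; apply: EFin_inj.
  rewrite EFinD -!xiE; [|exact: closed_borel..].
  by rewrite measureU//; exact: closed_borel.
have w_subadd A B : closed A -> closed B -> w (A `|` B) <= w A + w B.
  move=> cA cB; have cAB : closed (A `|` B) by exact: closedU.
  rewrite -subr_ge0; apply: cvgr_to_ge (cvgB (cvgD (wE A cA) (wE B cB)) (wE _ cAB)) _.
  apply: nearW => m; rewrite subr_ge0 -lee_fin EFinD -!xiE; [|exact: closed_borel..].
  by apply: measureU2; exact: closed_borel.
have wT : w setT = 1.
  apply: cvg_unique (wE _ closedT) _ => //.
  rewrite (_ : u setT = cst 1); first exact: cvg_cst.
  by apply/funext => m; rewrite /u probability_setT.
have [P PE] := content_probability hZ cZ w_homo w_subadd w_add wT.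
exists P; split=> [U r oU Ur|U V oU oV UV].
- rewrite PE//; apply: ge_ereal_sup => _ [C [cC CU] <-]; rewrite lee_fin.
  apply: cvgr_to_le (wE C cC) _; apply: FG; apply: filterS (Ur C cC CU) => m.
  by rewrite xiE ?lee_fin//; exact: closed_borel.
- rewrite !PE//; apply: ge_ereal_sup => _ [C [cC CU] <-].
  have [C' [cC' C'V CC']] := UV C cC CU.
  apply: (@le_trans _ _ (w C')%:E); last by apply: ereal_sup_ubound; exists C'.
  rewrite lee_fin; apply/ler_addgt0Pr => e e0; apply: w_le => //.
  apply: FG; apply: filterS (CC' e e0) => m.
  by rewrite !xiE -?EFinD ?lee_fin//; exact: closed_borel.
Qed.

(** * Invariant couplings *)

Section lift.
Context {R : realType} {G : topologicalGroupType} {X Y : pmetricType R}.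
Hypotheses (X_compact : compact [set: X]) (Y_compact : compact [set: Y]).
Variables (alpha : group_action G X) (beta : group_action G Y).
Hypotheses (alpha_isometric : isometric_action alpha)
  (beta_isometric : isometric_action beta)
  (alpha_orbit : forall x, continuous (fun g => alpha g x))
  (beta_orbit : forall y, continuous (fun g => beta g y)).

Let gX (g : G) (z : X * Y) : X * Y := (alpha g z.1, beta g z.2).

Lemma isometric_continuous (Z : pmetricType R) (f : Z -> Z) :
  (forall x y, mdist (f x) (f y) = mdist x y) -> continuous f.
Proof.
move=> fd x; apply/cvg_ballP => e e0; apply/nbhs_ballP; exists e => // y.
by rewrite !ballEmdist/= fd.
Qed.

Let gX_continuous g : continuous (gX g).
Proof.
move=> z; apply: cvg_pair.
- apply: (@continuous_comp _ _ _ fst (alpha g)); first exact: cvg_fst.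
  by apply: isometric_continuous; exact: alpha_isometric.
- apply: (@continuous_comp _ _ _ snd (beta g)); first exact: cvg_snd.
  by apply: isometric_continuous; exact: beta_isometric.
Qed.

Variables (d : R) (E : set (X * Y)).
Hypotheses (d_gt0 : 0 < d) (E_closed : closed E)
  (E_near : forall x0, exists y0, forall x g, mdist x x0 <= d ->
     E (alpha g x, beta g y0)).

Variable mu : probability (borel X) R.
Hypothesis mu_invariant : invariant_measure alpha mu.

(** One point is chosen in each cell of a finite Borel partition, and the [y0] that [E_near] gives
    there is used on the whole cell; the slack d in [E_near] is what permits this. Joint
    measurability then reduces to the continuity of single orbit maps. *)
Let measurable_selector : exists f : X -> Y,
  (forall x g, E (alpha g x, beta g (f x))) /\
  measurable_fun setT
    ((fun xg => beta xg.2 (f xg.1)) : borel X * borel G -> borel Y).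
Proof.
have [N [c [_ mc cd]]] := finite_borel_coloring X_compact d_gt0.
have /choice[r rP] (k : nat) : exists y : X, (exists x, c x = k) -> c y = k.
  have [[x xk]|nk] := pselect (exists x, c x = k); first by exists x.
  by exists point => /nk.
have [y yP] := choice E_near.
exists (fun x => y (r (c x))); split.
- by move=> x g; apply: yP; apply: cd; rewrite rP//; exists x.
- exact: (@measurable_colored _ _ _ _ c (fun k g => beta g (y (r k))) mc
    (fun k => @beta_orbit (y (r k)))).
Qed.

(* [xi] is the law of (alpha g x, beta g (f x)) for (x, g) of law [mu \x m]. *)
Lemma orbit_average (m : probability (borel G) R) :
  exists xi : probability (borel (X * Y)%type) R,
  [/\ forall A : set (borel X), measurable A -> xi (fst @^-1` A) = mu A,
      forall C : set (X * Y), closed C -> C `&` E = set0 -> xi C = 0%E &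
      forall (h : G) (e : R), 0 <= e -> (forall A : set (borel G), measurable A ->
        (m ((fun g => (h * g)%g) @^-1` A) <= m A + e%:E)%E) ->
      forall C : set (X * Y), closed C -> (xi (gX h @^-1` C) <= xi C + e%:E)%E].
Proof.
have [f [fE mf2]] := measurable_selector.
have lip g x x' : mdist (alpha g x) (alpha g x') <= mdist x x'.
  by rewrite alpha_isometric.
have mf1 := @measurable_lipschitz_continuous _ _ _ G X_compact
  (fun x g => alpha g x) lip alpha_orbit.
have mPhi := measurable_fun_borel_pair X_compact Y_compact mf1 mf2.
set Phi := (fun s => _) in mPhi.
have [xi xiE] := probability_pushforward (mu \x m)%E mPhi.
exists xi; split.
- move=> A mA; rewrite xiE.
  have mB : measurable (Phi @^-1` (fst @^-1` A)).
    exact: (measurable_preimage mf1 mA).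
  (* The integration over x is done first: for fixed g the section is the preimage of A under
     [alpha g], of mass [mu A] by invariance. *)
  rewrite [LHS](@product_measure_unique _ _ _ _ _ mu m (mu \x^ m)%E)//; last first.
    by move=> A1 A2 mA1 mA2; exact: product_measure2E.
  transitivity (\int[m]_g mu (ysection (Phi @^-1` (fst @^-1` A)) g))%E => //.
  rewrite (eq_integral (cst (mu A))) => [|g _].
    rewrite integral_cst//= [X in (_ * X)%E](_ : _ = 1%E) ?mule1//.
    exact: probability_setT.
  rewrite /= -(mu_invariant g mA) /pushforward; congr (mu _).
  by apply/seteqP; split=> x; rewrite /ysection /= ?inE// => /set_mem.
- move=> C cC CE; rewrite xiE (_ : _ @^-1` _ = set0) ?measure0//.
  apply/seteqP; split=> // xg /= Cxg.
  suff : (C `&` E) (Phi xg) by rewrite CE.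
  by split => //; exact: fE.
- move=> h e e0 hm C cC; rewrite !xiE.
  have mB : measurable (Phi @^-1` C).
    by apply: (measurable_preimage mPhi); exact: closed_borel.
  have mB' : measurable (Phi @^-1` (gX h @^-1` C)).
    apply: (measurable_preimage mPhi); apply: closed_borel.
    exact: preimage_closed.
  (* For fixed x, acting by h on the orbit point amounts to left translation by h in G, so the
     almost invariance of m applies section by section. *)
  have BB' x : xsection (Phi @^-1` (gX h @^-1` C)) x =
      (fun g => (h * g)%g) @^-1` xsection (Phi @^-1` C) x.
    apply/seteqP; split=> g; rewrite /xsection /= !inE /Phi /gX /=; by rewrite !actM.
  apply: (@le_trans _ _ (\int[mu]_x (m (xsection (Phi @^-1` C) x) + e%:E))%E).
    apply: ge0_le_integral => //.
    + exact: measurable_fun_xsection.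
    + by apply: emeasurable_funD => //; exact: measurable_fun_xsection.
    + by move=> x _; rewrite /= BB'; apply: hm; exact: measurable_xsection.
  rewrite ge0_integralD//.
  + rewrite integral_cst//= [X in (_ * X)%E](_ : _ = 1%E) ?mule1//.
    exact: probability_setT.
  + exact: measurable_fun_xsection.
Qed.

Lemma product_hausdorff : hausdorff_space (X * Y)%type.
Proof.
move=> [x y] [x' y'] cl; congr pair.
  apply: (@metric_hausdorff R X) => A B Ax Bx'.
  have [||[a b] [/= Aa Ba]] := cl (fst @^-1` A) (fst @^-1` B).
  - exact: (@cvg_fst _ _ (nbhs x) (nbhs y) _ A Ax).
  - exact: (@cvg_fst _ _ (nbhs x') (nbhs y') _ B Bx').
  by exists a.
apply: (@metric_hausdorff R Y) => A B Ay By'.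
have [||[a b] [/= Ab Bb]] := cl (snd @^-1` A) (snd @^-1` B).
- exact: (@cvg_snd _ _ (nbhs x) (nbhs y) _ A Ay).
- exact: (@cvg_snd _ _ (nbhs x') (nbhs y') _ B By').
by exists b.
Qed.

(** The almost invariant probabilities on G, indexed by a compact set and a tolerance, generate a
    filter that is proper by amenability. Along it every [xi m] has first marginal [mu] and charges
    no closed set disjoint from E. Since the complement of E is open, it is null for the cluster
    point too. *)
Lemma invariant_coupling : amenable R G ->
  exists2 nu : probability (borel Y) R, invariant_measure beta nu &
    coupled_in (fun x y => E (x, y)) mu nu.
Proof.
move=> amG.
pose almost_invariant (Ke : set G * R) : set (probability (borel G) R) :=
  [set m | forall h (A : set (borel G)), Ke.1 h -> measurable A ->
    (m ((fun g => (h * g)%g) @^-1` A) <= m A + Ke.2%:E)%E].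
pose F := filter_from [set Ke | compact Ke.1 /\ 0 < Ke.2] almost_invariant.
have FF : ProperFilter F.
  apply: filter_from_proper; last first.
    by move=> [K e] [/= cK e0]; exact: amenable_probability.
  apply: filter_from_filter.
    by exists (set0, 1); split=> //=; exact: compact0.
  move=> [K1 e1] [K2 e2] [/= cK1 e10] [/= cK2 e20].
  exists (K1 `|` K2, Num.min e1 e2).
    by split=> /=; [exact: compactU|rewrite lt_min e10 e20].
  move=> m mP; split=> h A /= Kh mA.
    apply: le_trans (mP h A (or_introl Kh) mA) _.
    by rewrite leeD// lee_fin ge_min lexx.
  apply: le_trans (mP h A (or_intror Kh) mA) _.
  by rewrite leeD// lee_fin ge_min lexx orbT.
have [xi xiP] := choice orbit_average.
have cZ : compact [set: X * Y] by rewrite -setXTT; exact: compact_setX.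
have [P [P_le P_mono]] := cluster_probability xi FF product_hausdorff cZ.
have mfst : measurable_fun setT (fst : borel (X * Y)%type -> borel X).
  by apply: (@continuous_measurable_borel (X * Y)%type) => z; exact: cvg_fst.
have msnd : measurable_fun setT (snd : borel (X * Y)%type -> borel Y).
  by apply: (@continuous_measurable_borel (X * Y)%type) => z; exact: cvg_snd.
have [P1 P1E] := probability_pushforward P mfst.
have [nu nuE] := probability_pushforward P msnd.
have P1mu : forall A : set (borel X), measurable A -> P1 A = mu A.
  apply: probability_open_le => U oU; rewrite P1E.
  have mU := open_borel oU.
  rewrite -(fineK (fin_num_measure mu _ mU)); apply: P_le => [|C cC CU].
    by apply: open_comp => // z _; exact: cvg_fst.
  apply: nearW => m; rewrite fineK ?fin_num_measure//.
  have [/(_ U mU) xi1 _ _] := xiP m.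
  apply: (@le_trans _ _ (xi m (fst @^-1` U))); last by rewrite xi1.
  apply: le_measure; rewrite ?inE//; first exact: closed_borel.
  exact: measurable_preimage mfst mU.
exists nu.
- move=> g.
  have mg : measurable_fun setT (beta g : borel Y -> borel Y).
    apply: continuous_measurable_borel; apply: isometric_continuous.
    exact: beta_isometric.
  have [nug nugE] := probability_pushforward nu mg.
  move=> A mA; rewrite /pushforward -nugE; move: A mA.
  apply: probability_open_le => U oU; rewrite nugE !nuE.
  apply: P_mono.
  + apply: open_comp => [z _|]; first exact: cvg_snd.
    apply: open_comp => // y _; apply: isometric_continuous.
    exact: beta_isometric.
  + by apply: open_comp => // z _; exact: cvg_snd.
  (* The witness is the translate of C by g: it lies over U, and its preimage under [gX g] is C, so
     almost invariance bounds the mass of C by that of the witness. *)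
  move=> C cC CU; exists (gX (g^-1)%g @^-1` C); split.
  + exact: preimage_closed.
  + move=> z /= /CU /=; by rewrite -actM mulgV act1.
  + move=> e e0; exists ([set g], e) => /=.
      by split=> //; exact: compact_set1.
    move=> m mP.
    have [_ _ xi_e] := xiP m.
    have := xi_e g e (ltW e0) (fun A mA => mP g A erefl mA) (gX (g^-1)%g @^-1` C).
    rewrite (_ : gX g @^-1` _ = C); last first.
      apply/seteqP; rewrite /gX; split=> -[x y] /=; by rewrite -!actM mulVg !act1.
    by apply; exact: preimage_closed.
- exists _, (borel (X * Y)%type), P, fst, snd; split=> //.
  + by move=> A mA; rewrite -P1E P1mu.
  + exists (~` E); split.
    * by apply: open_borel; exact: closed_openC.
    * apply/eqP; rewrite -measure_le0; apply: (P_le (~` E) 0).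
        exact: closed_openC.
      move=> C cC CE; apply: nearW => m.
      have [_ xi0 _] := xiP m; rewrite xi0//.
      by apply/seteqP; split=> // z [/CE].
    * by move=> [x y].
Qed.

End lift.

(** * Approximations of actions *)

Lemma equivariant_GH_lt (R : realType) (G : groupType) (X Y : metricType R)
    (alpha : group_action G X) (beta : group_action G Y) (e : R) :
  (equivariant_GH alpha beta < e%:E)%E ->
  exists r, [/\ 0 < r, r < e, exists f, eps_GHA alpha beta r f &
    exists f, eps_GHA beta alpha r f].
Proof.
move=> /ereal_inf_lt[_ [r [r0 f g] <-]]; rewrite lte_fin => re.
by exists r.
Qed.

Lemma eps_GHA_equivariant (R : realType) (G : groupType) (X Y : metricType R)
    (alpha : group_action G X) (beta : group_action G Y) (e : R) (f : X -> Y) :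
  eps_GHA alpha beta e f ->
  forall g x, mdist (beta g (f x)) (f (alpha g x)) <= e.
Proof.
move=> [_ fP] g x; rewrite -lee_fin; apply: le_trans (fP g).
by apply: ereal_sup_ubound; exists x.
Qed.

(** Distances in X are read off in [X_ n] through h. Comparing those before and after the action
    costs two distortions and two defects of equivariance, hence [e / 4]. For the orbit maps, one
    distortion, two defects and the variation of an orbit in [X_ n] share e in the same way. *)
Lemma isometric_orbit_of_limit (R : realType) (G : topologicalGroupType)
    (X_ : nat -> pmetricType R) (alpha_ : forall n, group_action G (X_ n))
    (X : pmetricType R) (alpha : group_action G X) :
  (forall n, continuous_action (alpha_ n)) ->
  (forall n, isometric_action (alpha_ n)) ->
  (forall e, 0 < e -> exists n r (h : X -> X_ n),
    [/\ 0 < r, r < e & eps_GHA alpha (alpha_ n) r h]) ->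
  isometric_action alpha /\ forall x, continuous (fun g => alpha g x).
Proof.
move=> cont isom lim; split=> [g x y|x g].
  apply/eqP; rewrite -subr_eq0 -normr_le0; apply/ler_addgt0Pr => e e0; rewrite add0r.
  have e4 : 0 < e / 4 by lra.
  have [n [r [h [r0 re hP]]]] := lim _ e4.
  have := hP.1.1 x y; have := hP.1.1 (alpha g x) (alpha g y).
  have := eps_GHA_equivariant hP g x; have := eps_GHA_equivariant hP g y.
  have := mdist_lipschitz (alpha_ n g (h x)) (h (alpha g x))
    (alpha_ n g (h y)) (h (alpha g y)).
  by rewrite isom !ler_norml => /andP[? ?] ? ? /andP[? ?] /andP[? ?]; apply/andP; lra.
apply/cvg_ballP => e e0.
have e4 : 0 < e / 4 by lra.
have [n [r [h [r0 re hP]]]] := lim _ e4.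
have orb : continuous (fun g => alpha_ n g (h x)).
  move=> k; apply: (@continuous_comp _ _ _ (fun g => (g, h x))
    (fun gx : G * X_ n => alpha_ n gx.1 gx.2)); last exact: cont.
  by apply: cvg_pair => //; exact: cvg_cst.
have := orb g _ (nbhsx_ballx (alpha_ n g (h x)) _ e4).
apply: (@filterS _ (nbhs g)) => k /ball_mdistP hk; apply/ball_mdistP.
have := hP.1.1 (alpha g x) (alpha k x).
have := eps_GHA_equivariant hP g x; have := eps_GHA_equivariant hP k x.
have := mdist_lipschitz (alpha_ n g (h x)) (h (alpha g x))
  (alpha_ n k (h x)) (h (alpha k x)).
rewrite !ler_norml => /andP[? ?] ? ? /andP[? ?]; lra.
Qed.

Section correspondence.
Context {R : realType} {G : topologicalGroupType} {X Y : pmetricType R}.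
Hypotheses (X_compact : compact [set: X]) (Y_compact : compact [set: Y])
  (G_amenable : amenable R G).
Variables (alpha : group_action G X) (beta : group_action G Y).
Hypotheses (alpha_isometric : isometric_action alpha)
  (beta_isometric : isometric_action beta)
  (alpha_orbit : forall x, continuous (fun g => alpha g x))
  (beta_orbit : forall y, continuous (fun g => beta g y)).
Variables (e : R) (f : X -> Y).
Hypotheses (e_gt0 : 0 < e) (f_GHA : eps_GHA alpha beta e f).

(* The graph of f is not closed, as f need not be continuous. *)
Let E : set (X * Y) :=
  [set z | forall x', `|mdist z.1 x' - mdist z.2 (f x')| <= 4 * e].

Let E_closed : closed E.
Proof.
have -> : E = \bigcap_x' [set z | `|mdist z.1 x' - mdist z.2 (f x')| <= 4 * e].
  by apply/seteqP; split=> z Ez x' => [_|]; apply: Ez.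
apply: closed_bigI => x' _.
have c1 : continuous (fun z : X * Y => mdist z.1 x').
  by apply: mdist_continuous => z; [exact: cvg_fst|exact: cvg_cst].
have c2 : continuous (fun z : X * Y => mdist z.2 (f x')).
  by apply: mdist_continuous => z; [exact: cvg_snd|exact: cvg_cst].
apply: (@preimage_closed _ _ (fun z : X * Y => `|mdist z.1 x' - mdist z.2 (f x')|)
  [set r | r <= 4 * e]); last exact: closed_le.
by move=> z _; apply: cvg_norm; apply: cvgB; [exact: c1|exact: c2].
Qed.

(** With x' equal to [x2] in both conditions, [y2] is within [4 * e] of [f x2], and the distance
    from [y1] to [f x2] is within [4 * e] of that from [x1] to [x2]. *)
Let E_distortion x1 y1 x2 y2 : E (x1, y1) -> E (x2, y2) ->
  `|mdist x1 x2 - mdist y1 y2| <= 8 * e.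
Proof.
move=> /(_ x2) /= E1 /(_ x2) /= E2; move: E1 E2.
have := mdist_lipschitz y1 y1 y2 (f x2).
rewrite !mdistxx add0r sub0r normrN !ler_norml (metric_sym y2).
by move=> /andP[? ?] /andP[? ?] /andP[? ?]; apply/andP; lra.
Qed.

Let E_left x0 : exists y0, forall x g, mdist x x0 <= e -> E (alpha g x, beta g y0).
Proof.
exists (f x0) => x g xx0 x' /=.
have := eps_GHA_equivariant f_GHA g x0.
have := f_GHA.1.1 (alpha g x0) x'.
have := mdist_lipschitz (alpha g x) (alpha g x0) x' x'.
have := mdist_lipschitz (beta g (f x0)) (f (alpha g x0)) (f x') (f x').
rewrite !mdistxx alpha_isometric !ler_norml.
by move=> /andP[? ?] /andP[? ?] /andP[? ?] ?; apply/andP; lra.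
Qed.

(** This fixes the constant [4 * e] in E: passing from y to [y0], from [y0] to [f x0], exchanging f
    with the action, and the distortion of f cost e each. On the other side, [E_left] spends only
    [3 * e]. *)
Let E_right y0 : exists x0, forall y g, mdist y y0 <= e -> E (alpha g x0, beta g y).
Proof.
have [x0 y0x0] := f_GHA.1.2 y0; exists x0 => y g yy0 x' /=.
have := eps_GHA_equivariant f_GHA g x0.
have := f_GHA.1.1 (alpha g x0) x'.
have := mdist_lipschitz (beta g y) (beta g (f x0)) (f x') (f x').
have := mdist_lipschitz (beta g (f x0)) (f (alpha g x0)) (f x') (f x').
have := metric_triangle y y0 (f x0).
rewrite !mdistxx beta_isometric !ler_norml.
by move=> ? /andP[? ?] /andP[? ?] /andP[? ?] ?; apply/andP; lra.
Qed.

Lemma gromov_hausdorff_invariant_wasserstein (p : R) : 1 <= p ->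
  (gromov_hausdorff (invariant_wasserstein alpha p)
     (invariant_wasserstein beta p) <= (8 * e)%:E)%E.
Proof.
move=> p_ge1; have e8 : 0 < 8 * e by rewrite mulr_gt0.
apply: (@gromov_hausdorff_le _ _ _ _ _
  (fun mu nu => coupled_in (fun x y => E (x, y)) (sval mu) (sval nu))) => //.
- by move=> mu; exact: wassersteinxx.
- by move=> mu nu; exact: wasserstein_sym.
- by move=> nu mu rho; exact: wasserstein_triangle.
- by move=> mu; exact: wassersteinxx.
- by move=> mu nu; exact: wasserstein_sym.
- by move=> nu mu rho; exact: wasserstein_triangle.
- move=> [mu mu_inv].
  have [nu nu_inv munu] := invariant_coupling X_compact Y_compact alpha_isometric
    beta_isometric alpha_orbit beta_orbit e_gt0 E_closed E_left mu_inv G_amenable.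
  by exists (exist _ nu nu_inv).
- move=> [nu nu_inv].
  have E'_closed : closed [set z : Y * X | E (z.2, z.1)].
    apply: (@preimage_closed _ _ (fun z : Y * X => (z.2, z.1)) E) => // z _.
    exact: swap_continuous.
  have [mu mu_inv numu] := invariant_coupling Y_compact X_compact beta_isometric
    alpha_isometric beta_orbit alpha_orbit e_gt0 E'_closed E_right nu_inv G_amenable.
  by exists (exist _ mu mu_inv); exact: coupled_in_sym numu.
- move=> [mu1 ?] [nu1 ?] [mu2 ?] [nu2 ?] /= m1 m2.
  have W21 : wasserstein p nu1 nu2 <= wasserstein p mu1 mu2 + 8 * e.
    apply: wasserstein_distortion m1 m2 => //; first exact: ltW.
    move=> x1 y1 x2 y2 E1 E2; have := E_distortion E1 E2.
    by rewrite ler_norml => /andP[]; lra.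
  have W12 : wasserstein p mu1 mu2 <= wasserstein p nu1 nu2 + 8 * e.
    apply: wasserstein_distortion (coupled_in_sym m1) (coupled_in_sym m2) => //.
      exact: ltW.
    move=> y1 x1 y2 x2 E1 E2; have := E_distortion E1 E2.
    by rewrite ler_norml => /andP[]; lra.
  by rewrite /invariant_wasserstein/= ler_norml lerBlDl W12 andbT lerBrDl lerBlDr.
Qed.

End correspondence.

Lemma gromov_hausdorff_ge0 (R : realType) (T1 T2 : Type) (d1 : T1 -> T1 -> R)
    (d2 : T2 -> T2 -> R) : (0 <= gromov_hausdorff d1 d2)%E.
Proof.
apply: le_ereal_inf_tmp => _ [Z [f1 [f2 [_ _ ->]]]].
by apply: le_ereal_inf_tmp => _ [r [r0 _ _] <-]; rewrite lee_fin ltW.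
Qed.

Theorem theorem1p3 (R : realType) (G : topologicalGroupType)
    (G_hausdorff : hausdorff_space G)
    (G_locally_compact : locally_compact [set: G])
    (G_sigma_compact : sigma_compact G)
    (G_amenable : amenable R G)
    (X_ : nat -> pmetricType R)
    (X_compact : forall n, compact [set: X_ n])
    (alpha_ : forall n, group_action G (X_ n))
    (alpha_continuous : forall n, continuous_action (alpha_ n))
    (alpha_isometric : forall n, isometric_action (alpha_ n))
    (p : R) (p_ge1 : 1 <= p)
    (X : pmetricType R) (X_compact' : compact [set: X])
    (alpha : group_action G X)
    (alpha_cvg : (fun n => equivariant_GH (alpha_ n) alpha) @ \oo --> 0%E) :
  isometric_action alpha /\
  (fun n => gromov_hausdorff
              (invariant_wasserstein (alpha_ n) p)
              (invariant_wasserstein alpha p)) @ \oo --> 0%E.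
Proof.
have alpha_near (e : R) : 0 < e ->
    \forall n \near \oo, (equivariant_GH (alpha_ n) alpha < e%:E)%E.
  move=> e0; apply: (alpha_cvg [set u | (u < e%:E)%E]).
  by apply: open_ereal_lt'; rewrite lte_fin.
(* The maps from alpha to [alpha_ n] are used here; those in the other direction give the
   correspondence below. *)
have [|isom orbit] := isometric_orbit_of_limit alpha_continuous alpha_isometric
    (alpha := alpha).
  move=> e /alpha_near[n _ /(_ n (leqnn n)) /=].
  by move=> /equivariant_GH_lt[r [r0 re _ [h hP]]]; exists n, r, h.
split=> //.
have GH_near (e : R) : 0 < e -> \forall n \near \oo, (gromov_hausdorff
    (invariant_wasserstein (alpha_ n) p) (invariant_wasserstein alpha p) <= e%:E)%E.
  (* The factor 8 is the distortion of E. *)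
  move=> e0; have e8 : 0 < e / 8 by lra.
  apply: filterS (alpha_near _ e8) => n.
  move=> /equivariant_GH_lt[r [r0 re [f fP] _]].
  apply: (@le_trans _ _ (8 * r)%:E); last by rewrite lee_fin; lra.
  apply: gromov_hausdorff_invariant_wasserstein fP _ _ => //.
  move=> x g; apply: (@continuous_comp _ _ _ (fun g => (g, x))
    (fun gx : G * X_ n => alpha_ n gx.1 gx.2)); last exact: alpha_continuous.
  by apply: cvg_pair => //; exact: cvg_cst.
apply/fine_cvgP; split.
  apply: filterS (GH_near 1 ltr01) => n GH1.
  by rewrite ge0_fin_numE ?gromov_hausdorff_ge0// (le_lt_trans GH1)// ltry.
apply/cvgrPdist_le => e e0; apply: filterS (GH_near e e0) => n GHe.
rewrite sub0r normrN ger0_norm; last by rewrite fine_ge0// gromov_hausdorff_ge0.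
rewrite -lee_fin fineK// ge0_fin_numE ?gromov_hausdorff_ge0//.
exact: le_lt_trans GHe (ltry _).
Qed.
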